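(* Let $(\pi,N)$ be a Poisson-Nijenhuis structure on a Lie algebroid $(A,[\cdot,\cdot],\rho)$. Then the derivation $\underline N$ is weak Nijenhuis with respect to the $L_\infty$-structure $l_1^{[\cdot,\cdot],\pi}+l_2^{[\cdot,\cdot]}$ on $\Gamma(\wedge A)[2]$ associated to the Poisson structure $\pi$ and the Lie algebroid $(A,[\cdot,\cdot],\rho)$. In this case, the deformed structure $[\underline N,\ l_1^{[\cdot,\cdot],\pi}+l_2^{[\cdot,\cdot]}]_{_{RN}}$ is the $L_\infty$-structure associated to the Poisson structure $-\pi_{_N}$ and the Lie algebroid $(A,[\cdot,\cdot]_N,\rho\circ N)$.
   Context: Let $(A,\mu=[\cdot,\cdot],\rho)$ be a Lie algebroid over $M$, $d^A$ its differential on $\Gamma(\wedge A^* )$ and $\mathcal L^A_X=d^A\iota_X+\iota_Xd^A$ the Lie derivative. $\Gamma(\wedge A)[2]$ is $\Gamma(\wedge A)$ graded so that $\Gamma(\wedge^pA)$ has degree $p-2$. $[\cdot,\cdot]_{_{SN}}$ is the Schouten-Nijenhuis bracket: it extends the Lie bracket, $[X,f]_{_{SN}}=\rho(X)f$, $[P,Q]_{_{SN}}=-(-1)^{(p-1)(q-1)}[Q,P]_{_{SN}}$, $[P,Q\wedge R]_{_{SN}}=[P,Q]_{_{SN}}\wedge R+(-1)^{(p-1)q}Q\wedge[P,R]_{_{SN}}$. For a bivector $\pi\in\Gamma(\wedge^2A)$, $l_1^{[\cdot,\cdot],\pi}(P)=[\pi,P]_{_{SN}}$; and $l_2^{[\cdot,\cdot]}(P,Q)=(-1)^{p-1}[P,Q]_{_{SN}}$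 for $P\in\Gamma(\wedge^pA)$. The $L_\infty$-structure associated to a Poisson structure $\pi$ (i.e. $[\pi,\pi]_{_{SN}}=0$) and the Lie algebroid $(A,[\cdot,\cdot],\rho)$ is $l_1^{[\cdot,\cdot],\pi}+l_2^{[\cdot,\cdot]}$; the same definitions apply to other Lie algebroid structures on $A$. For a $(1,1)$-tensor $N:A\to A$: $[X,Y]_N=[NX,Y]+[X,NY]-N[X,Y]$; $N$ is Nijenhuis if $[NX,NY]=N[X,Y]_N$; then $(A,\mu^N=[\cdot,\cdot]_N,\rho\circ N)$ is a Lie algebroid. $N^*:A^*\to A^*$ is the transpose; $\pi^\#:A^*\to A$ is given by $\langle\beta,\pi^\#\alpha\rangle=\pi(\alpha,\beta)$; $\pi_{_N}(\alpha,\beta)=\langle\beta,N\pi^\#\alpha\rangle$; $\{\alpha,\beta\}_\pi^\mu=\mathcal L^A_{\pi^\#\alpha}\beta-\mathcal L^A_{\pi^\#\beta}\alpha-d^A(\pi(\alpha,\beta))$ for $\alpha,\beta\in\Gamma(A^* )$. $(\pi,N)$ is a Poisson-Nijenhuis structure if $N$ is Nijenhuis, $[\pi,\pi]_{_{SN}}=0$, $N\circ\pi^\#=\pi^\#\circ N^*$, and $(\{\alpha,\beta\}_\pi^\mu)_{N^*}=\{\alpha,\beta\}_\pi^{\mu^N}$ for all $\alpha,\beta$, where $(\{\alpha,\beta\}_\pi^\mu)_{N^*}=\{N^*\alpha,\beta\}_\pi^\mu+\{\alpha,N^*\beta\}_\pi^\mu-N^*\{\alpha,\beta\}_\pi^\mu$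 and the right side is computed with the Lie algebroid $(A,\mu^N,\rho\circ N)$. $\underline N$ is the degree-zero linear map on $\Gamma(\wedge A)[2]$ with $\underline N(f)=0$ on functions and $\underline N(P_1\wedge\cdots\wedge P_p)=\sum_iP_1\wedge\cdots\wedge N(P_i)\wedge\cdots\wedge P_p$. A symmetric vector valued $k$-form on a graded vector space $E$ is a graded symmetric $k$-linear map $K:E^k\to E$ ($k=0$: an element of $E$), of degree $\bar K$ if $|K(X_1,\dots,X_k)|=\sum|X_i|+\bar K$. For a $k$-form $K$ and an $l$-form $L$ ($l\ge1$), $\iota_KL(X_1,\dots,X_{k+l-1})=\sum_{\sigma\in Sh(k,l-1)}\epsilon(\sigma)L(K(X_{\sigma(1)},\dots,X_{\sigma(k)}),\dots,X_{\sigma(k+l-1)})$ (unshuffles, Koszul sign); $\iota_KL=0$ for $L\in E$; $\iota_XK=K(X,\cdot,\dots)$ for $X\in E$. $[K,L]_{_{RN}}=\iota_KL-(-1)^{\bar K\bar L}\iota_LK$, extended to sums. An $L_\infty$-structure is a sum $\nu=\sum_{i\ge1}l_i$ of symmetric vector valued $i$-forms of degree $1$ with $[\nu,\nu]_{_{RN}}=0$. $\mathcal N$ of degree zero is weak Nijenhuis with respect to a form $\nu$ of degree $1$ if $[\nu,[\mathcal N,[\mathcal N,\nu]_{_{RN}}]_{_{RN}}]_{_{RN}}=0$; the deformed structure is $[\mathcal N,\nu]_{_{RN}}$.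
   Formalization: Taken literally the description of the deformed structure fails (N=2Id: unary part -2[π,P], not [-π_N,P]_N=-4[π,P]); proved instead: it equals l_1^{[,],-π_N}+l_2^{[,]_N} = l_1^{[,]_N,-π}+l_2^{[,]_N}, with -π_N Poisson for both brackets. *)

(* Defs.v *)
From HB Require Import structures.
From mathcomp Require Import all_boot all_order all_fingroup all_algebra.

Set Implicit Arguments.
Unset Strict Implicit.
Unset Printing Implicit Defensive.

Import GRing.Theory Num.Theory.
Local Open Scope ring_scope.

(* A family of vector spaces indexed by int, realised as subspaces of one
   ambient space so that no transport along equalities of degrees is needed. *)
Record gradedSpace (K : fieldType) := GradedSpace {
  gcar :> lmodType K;
  ghom : int -> gcar -> Prop;
  ghom0 : forall d, ghom d 0;
  ghom_lin : forall d (a : K) x y,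
    ghom d x -> ghom d y -> ghom d (a *: x + y) }.

(* Arguments of a multilinear map are homogeneous elements labelled by their
   degree.  A term of type [vform] is a family (equivalently, a formal sum)
   indexed by k of k-ary maps, the k-ary one being its restriction to lists of
   size k.  Only its values on [homlist]s are meaningful. *)
Definition vform (V : Type) := seq (int * V) -> V.

Definition psign (K : nzRingType) (d : int) : K := (-1) ^+ `|d|%N.

Section RichardsonNijenhuis.
Variables (K : fieldType) (E : gradedSpace K).

Fixpoint homlist (xs : seq (int * E)) : Prop :=
  if xs is t :: ys then ghom t.1 t.2 /\ homlist ys else True.

Definition degsum (xs : seq (int * E)) : int := \sum_(t <- xs) t.1.

Definition eq_vform (F G : vform E) : Prop :=
  forall xs, homlist xs -> F xs = G xs.

Definition add_vform (F G : vform E) : vform E := fun xs => F xs + G xs.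

(* Every component of [F] is a symmetric vector valued form of degree [c]. *)
Record is_symform (c : int) (F : vform E) : Prop := IsSymform {
  symform_deg : forall xs, homlist xs -> ghom (degsum xs + c) (F xs);
  symform_lin : forall xs ys d (a : K) (x y : E),
    homlist (xs ++ (d, x) :: ys) -> homlist (xs ++ (d, y) :: ys) ->
    F (xs ++ (d, a *: x + y) :: ys)
    = a *: F (xs ++ (d, x) :: ys) + F (xs ++ (d, y) :: ys);
  symform_sym : forall xs ys s t,
    homlist (xs ++ s :: t :: ys) ->
    F (xs ++ s :: t :: ys)
    = psign K (s.1 * t.1) *: F (xs ++ t :: s :: ys) }.

Definition unshuffle (n k : nat) (s : 'S_n) : bool :=
  [forall i : 'I_n, forall j : 'I_n,
    (i < j)%N && ((j < k)%N || (k <= i)%N) ==> (s i < s j)%N].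

Definition koszul (n : nat) (d : 'I_n -> int) (s : 'S_n) : K :=
  \prod_(i < n) \prod_(j < n | (i < j)%N && (s j < s i)%N)
    psign K (d (s i) * d (s j)).

Definition permlist (xs : seq (int * E)) (s : 'S_(size xs)) :
  seq (int * E) := [seq tnth (in_tuple xs) (s i) | i <- enum 'I_(size xs)].

(* iota_F G for F of degree c, all arities at once: the summand k feeds the
   k-ary component of F into the first slot of the component of G of arity
   (size xs - k).+1.  The arity of G is never 0, and for k = 0 the term is
   the evaluation of G at the element F [::] of E. *)
Definition insertion (c : int) (F G : vform E) : vform E := fun xs =>
  \sum_(k < (size xs).+1) \sum_(s : 'S_(size xs) | unshuffle k s)
    koszul (fun i => (tnth (in_tuple xs) i).1) s *:
      (let ys := take k (permlist s) in
       let zs := drop k (permlist s) in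
       G ((degsum ys + c, F ys) :: zs)).

Definition RN (c c' : int) (F G : vform E) : vform E := fun xs =>
  insertion c F G xs - psign K (c * c') *: insertion c' G F xs.

Definition is_Linfty (nu : vform E) : Prop :=
  [/\ nu [::] = 0, is_symform 1 nu
    & eq_vform (RN 1 1 nu nu) (fun=> 0)].

Definition weak_nijenhuis (F nu : vform E) : Prop :=
  [/\ is_symform 0 F, is_symform 1 nu
    & eq_vform (RN 1 1 nu (RN 0 1 F (RN 0 1 F nu))) (fun=> 0)].

End RichardsonNijenhuis.

(* The algebra C stands for the functions on the base, and a vector bundle is
   given by its module of sections, a direct summand of a free module of finite
   rank (Serre-Swan). *)

Record vbundle (C : comNzRingType) := VBundle {
  sections :> lmodType C;
  brank : nat;
  bemb : {linear sections -> 'rV[C]_brank};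
  bprj : {linear 'rV[C]_brank -> sections};
  bembK : cancel bemb bprj }.

Record anchored_bracket (C : comNzRingType) (A : lmodType C) :=
  AnchoredBracket { lbr : A -> A -> A; anc : A -> C -> C }.

Section LieAlgebroid.
Variables (K : fieldType) (C : comAlgType K) (A : lmodType C).

Record is_lie_algebroid (mu : anchored_bracket A) : Prop := IsLieAlgebroid {
  lbr_linr : forall X (k : K) Y Z,
    lbr mu X (k%:A *: Y + Z) = k%:A *: lbr mu X Y + lbr mu X Z;
  lbr_skew : forall X Y, lbr mu X Y = - lbr mu Y X;
  lbr_jacobi : forall X Y Z,
    lbr mu X (lbr mu Y Z) = lbr mu (lbr mu X Y) Z + lbr mu Y (lbr mu X Z);
  anc_lin : forall f X Y g, anc mu (f *: X + Y) g = f * anc mu X g + anc mu Y g;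
  anc_klin : forall X (k : K) f g,
    anc mu X (k *: f + g) = k *: anc mu X f + anc mu X g;
  anc_der : forall X f g, anc mu X (f * g) = anc mu X f * g + f * anc mu X g;
  anc_lbr : forall X Y f,
    anc mu (lbr mu X Y) f = anc mu X (anc mu Y f) - anc mu Y (anc mu X f);
  lbr_leibniz : forall X f Y,
    lbr mu X (f *: Y) = f *: lbr mu X Y + anc mu X f *: Y }.

Definition deform (mu : anchored_bracket A) (N : A -> A) : anchored_bracket A :=
  AnchoredBracket
    (fun X Y => lbr mu (N X) Y + lbr mu X (N Y) - N (lbr mu X Y))
    (fun X => anc mu (N X)).

Definition nijenhuis (mu : anchored_bracket A) (N : A -> A) : Prop :=
  forall X Y, lbr mu (N X) (N Y) = N (lbr (deform mu N) X Y).

End LieAlgebroid.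

Section Cartan.
Variables (C : comNzRingType) (A : lmodType C) (mu : anchored_bracket A).

(* d^A on functions and on 1-forms, and L_X = d i_X + i_X d on 1-forms *)
Definition dA0 (f : C) (X : A) : C := anc mu X f.

Definition dA1 (b : A -> C) (X Y : A) : C :=
  anc mu X (b Y) - anc mu Y (b X) - b (lbr mu X Y).

Definition lieA (X : A) (b : A -> C) (Y : A) : C :=
  dA0 (b X) Y + dA1 b X Y.

End Cartan.

Record exteriorAlgebra (C : comNzRingType) (A : lmodType C) :=
  ExteriorAlgebra {
    extalg :> algType C;
    ext_in : {linear A -> extalg};
    ext_sq : forall X, ext_in X * ext_in X = 0;
    ext_lift : forall (B : algType C) (f : {linear A -> B}),
      (forall X, f X * f X = 0) -> {lrmorphism extalg -> B};
    ext_liftE : forall (B : algType C) (f : {linear A -> B})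
      (f2 : forall X, f X * f X = 0) X, ext_lift f2 (ext_in X) = f X;
    ext_uniq : forall (B : algType C) (g h : {lrmorphism extalg -> B}),
      (forall X, g (ext_in X) = h (ext_in X)) -> g =1 h }.

Section Multivectors.
Variables (C : comNzRingType) (A : lmodType C) (W : exteriorAlgebra A).

Definition mvprod (p : nat) (X : 'I_p -> A) : W := \prod_(i < p) ext_in W (X i).

Definition mvect_nat (p : nat) (P : W) : Prop :=
  exists s : seq (C * ('I_p -> A)), P = \sum_(t <- s) t.1 *: mvprod t.2.

(* P is a section of the p-th exterior power, which is 0 for p < 0. *)
Definition mvect (p : int) (P : W) : Prop :=
  if p is Posz n then mvect_nat n P else P = 0.

Lemma mvect0 p : mvect p 0.
Proof. by case: p => // n; exists [::]; rewrite big_nil. Qed.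

Lemma mvect_lin p (f : C) P Q : mvect p P -> mvect p Q -> mvect p (f *: P + Q).
Proof.
case: p => [n|n] /=; last by move=> -> ->; rewrite scaler0 addr0.
case=> s -> [t ->]; exists ([seq (f * u.1, u.2) | u <- s] ++ t).
rewrite big_cat big_map scaler_sumr /=; congr (_ + _).
by apply: eq_bigr => u _; rewrite scalerA.
Qed.

End Multivectors.

Definition restr (K : fieldType) (C : comAlgType K) (V : lmodType C) : Type := V.

Section Restriction.
Variables (K : fieldType) (C : comAlgType K) (V : lmodType C).

HB.instance Definition _ := GRing.Zmodule.on (restr V).

Let kscale (k : K) (v : restr V) : restr V := (k%:A : C) *: (v : V).

Fact kscaleA a b v : kscale a (kscale b v) = kscale (a * b) v.
Proof. by rewrite /kscale scalerA -scalerAl mul1r scalerA. Qed.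
Fact kscale1 : left_id 1 kscale.
Proof. by move=> v; rewrite /kscale !scale1r. Qed.
Fact kscaleDr : right_distributive kscale +%R.
Proof. by move=> a u v; rewrite /kscale scalerDr. Qed.
Fact kscaleDl v : {morph kscale^~ v : a b / a + b}.
Proof. by move=> a b; rewrite /kscale !scalerDl. Qed.

HB.instance Definition _ := GRing.Zmodule_isLmodule.Build K (restr V)
  kscaleA kscale1 kscaleDr kscaleDl.

End Restriction.

(* Gamma(wedge A)[2]: p-vectors have degree p - 2. *)
Section ShiftedMultivectors.
Variables (K : fieldType) (C : comAlgType K) (A : lmodType C).
Variable W : exteriorAlgebra A.

Definition mvhom (d : int) (P : restr W) : Prop := @mvect C A W (d + 2) P.

Fact mvhom0 d : mvhom d 0. Proof. exact: mvect0. Qed.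

Fact mvhom_lin d (a : K) (x y : restr W) :
  mvhom d x -> mvhom d y -> mvhom d (a *: x + y).
Proof. exact: mvect_lin. Qed.

Definition mvspace : gradedSpace K := GradedSpace mvhom0 mvhom_lin.

End ShiftedMultivectors.
Arguments mvspace {K C A} W.

(* The value pi(a,b) of a bivector pi on 1-forms a and b is the coefficient on
   e1 /\ e2 of the image of pi under the algebra morphism from wedge A to
   wedge (C^2) induced by X |-> a X e1 + b X e2.  Here wedge (C^2) acts on
   itself by left multiplication, in the basis 1, e1, e2, e1 /\ e2. *)
Section Pairing.
Variables (C : comNzRingType) (A : lmodType C) (W : exteriorAlgebra A).
Variables a b : {linear A -> C^o}.

Let e1 : 'M[C]_4 := delta_mx (inord 1) (inord 0) + delta_mx (inord 3) (inord 2).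
Let e2 : 'M[C]_4 := delta_mx (inord 2) (inord 0) - delta_mx (inord 3) (inord 1).

Definition pair_rep (X : A) : 'M[C]_4 := (a X : C) *: e1 + (b X : C) *: e2.

Fact pair_rep_linear : linear pair_rep.
Proof.
move=> f X Y; rewrite /pair_rep.
have linE (c : {linear A -> C^o}) : c (f *: X + Y) = f * (c X : C) + (c Y : C).
  exact: linearP.
rewrite !linE; by move: e1 e2 => u v; rewrite scalerDr !scalerA !scalerDl addrACA.
Qed.
HB.instance Definition _ :=
  GRing.isLinear.Build C A 'M[C]_4 *:%R pair_rep pair_rep_linear.

Let dmxM (i j k l : nat) : (i < 4)%N -> (j < 4)%N -> (k < 4)%N -> (l < 4)%N ->
  (delta_mx (inord i) (inord j) : 'M[C]_4) * delta_mx (inord k) (inord l)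
  = if j == k then delta_mx (inord i) (inord l) else 0.
Proof.
move=> ? hj hk ?; rewrite -[LHS]/(_ *m _); case: eqP => [->|njk].
  exact: mul_delta_mx.
by apply: mul_delta_mx_0; rewrite -val_eqE /= !inordK //; apply/eqP.
Qed.

Let e11 : e1 * e1 = 0.
Proof. by rewrite /e1 mulrDl !mulrDr !dmxM //= !addr0. Qed.
Let e22 : e2 * e2 = 0.
Proof. by rewrite /e2 mulrBl !mulrBr !dmxM //= !subr0. Qed.
Let e12 : e1 * e2 = delta_mx (inord 3) (inord 0).
Proof. by rewrite /e1 /e2 mulrDl !mulrBr !dmxM //= !subr0 add0r. Qed.
Let e21 : e2 * e1 = - delta_mx (inord 3) (inord 0).
Proof. by rewrite /e1 /e2 mulrBl !mulrDr !dmxM //= !addr0 add0r. Qed.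

Let pair_repM X Y : pair_rep X * pair_rep Y
  = ((a X : C) * b Y - (b X : C) * a Y) *: delta_mx (inord 3) (inord 0).
Proof.
rewrite /pair_rep mulrDl !mulrDr -!scalerAl -!scalerAr !scalerA e11 e22 e12 e21.
by rewrite !scaler0 add0r addr0 scalerN scalerBl.
Qed.

Fact pair_rep_sq X : pair_rep X * pair_rep X = 0.
Proof. by rewrite pair_repM mulrC subrr scale0r. Qed.

Definition mvpair (P : W) : C :=
  (@ext_lift C A W _ pair_rep pair_rep_sq P : 'M[C]_4) (inord 3) (inord 0).

Lemma mvpair_linear (f : C) P Q :
  mvpair (f *: P + Q) = f * mvpair P + mvpair Q.
Proof. by rewrite /mvpair linearP /= !mxE. Qed.

Lemma mvpair_wedge X Y :
  mvpair (ext_in W X * ext_in W Y) = (a X : C) * b Y - (a Y : C) * b X.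
Proof.
rewrite /mvpair rmorphM /= !ext_liftE pair_repM !mxE !eqxx mulr1.
by rewrite [(b X : C) * _]mulrC.
Qed.

End Pairing.

(* pi^# a is the section with <b, pi^# a> = pi(a,b) for all b. *)
Section Sharp.
Variables (C : comNzRingType) (A : vbundle C) (W : exteriorAlgebra A).

Definition bcoord (i : 'I_(brank A)) (X : A) : C^o := bemb A X 0 i.

Fact bcoord_linear i : linear (bcoord i).
Proof. by move=> f X Y; rewrite /bcoord linearP !mxE. Qed.
HB.instance Definition _ i :=
  GRing.isLinear.Build C A C^o *:%R (bcoord i) (bcoord_linear i).

Definition sharp (pi : W) (a : {linear A -> C^o}) : A :=
  \sum_(i < brank A) mvpair a (bcoord i) pi *: bprj A (delta_mx 0 i).

Lemma sharpE pi a (b : {linear A -> C^o}) :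
  mvect 2 pi -> b (sharp pi a) = mvpair a b pi.
Proof.
have bE Y : b Y = \sum_i (bcoord i Y : C) * b (bprj A (delta_mx 0 i)).
  rewrite -{1}[Y](@bembK C A) [X in bprj A X]row_sum_delta !linear_sum.
  by apply: eq_bigr => i _; rewrite !linearZ.
case=> s ->; have sumE (c : {linear A -> C^o}) : mvpair a c
    (\sum_(t <- s) t.1 *: mvprod W t.2) = \sum_(t <- s) t.1 *
      ((a (t.2 ord0) : C) * c (t.2 ord_max) - (a (t.2 ord_max) : C) * c (t.2 ord0)).
  elim: s => [|t s IH].
    rewrite !big_nil -[X in mvpair _ _ X](addNr 0) -[X in X + _]scaleN1r.
    by rewrite mvpair_linear mulN1r addNr.
  rewrite !big_cons mvpair_linear IH /mvprod big_ord_recl big_ord1 mvpair_wedge.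
  by rewrite (_ : lift ord0 ord0 = ord_max) //; apply: val_inj.
rewrite /sharp linear_sum sumE.
under eq_bigr => i _ do rewrite linearZ /= sumE scaler_suml.
rewrite exchange_big /=; apply: eq_bigr => t _.
rewrite [b (t.2 ord_max)]bE [b (t.2 ord0)]bE !mulr_sumr -sumrB mulr_sumr.
by apply: eq_bigr => i _; rewrite -[_ *: _]/(_ * _) -mulrA mulrBl !mulrA.
Qed.

End Sharp.

Section Schouten.
Variables (K : fieldType) (C : comAlgType K) (A : lmodType C).
Variable W : exteriorAlgebra A.

(* These axioms determine the bracket on multivectors; the degree axiom
   contains [f,g] = 0 for functions f and g. *)
Record is_schouten (mu : anchored_bracket A) (sn : W -> W -> W) : Prop :=
  IsSchouten {
    sn_linl : forall (k : K) P Q S,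
      sn (k%:A *: P + Q) S = k%:A *: sn P S + sn Q S;
    sn_linr : forall (k : K) P Q S,
      sn S (k%:A *: P + Q) = k%:A *: sn S P + sn S Q;
    sn_deg : forall (p q : nat) P Q, mvect p P -> mvect q Q ->
      mvect (p%:Z + q%:Z - 1) (sn P Q);
    sn_lbr : forall X Y, sn (ext_in W X) (ext_in W Y) = ext_in W (lbr mu X Y);
    sn_anc : forall X (f : C), sn (ext_in W X) f%:A = (anc mu X f)%:A;
    sn_skew : forall (p q : nat) P Q, mvect p P -> mvect q Q ->
      sn P Q = - (psign C ((p%:Z - 1) * (q%:Z - 1)) *: sn Q P);
    sn_wedge : forall (p q r : nat) P Q S,
      mvect p P -> mvect q Q -> mvect r S ->
      sn P (Q * S)
      = sn P Q * S + psign C ((p%:Z - 1) * q%:Z) *: (Q * sn P S) }.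

Record is_underline (N : A -> A) (uN : W -> W) : Prop := IsUnderline {
  uN_lin : forall (k : K) P Q, uN (k%:A *: P + Q) = k%:A *: uN P + uN Q;
  uN_fun : forall f : C, uN f%:A = 0;
  uN_prod : forall (p : nat) (X : 'I_p -> A),
    uN (mvprod W X)
    = \sum_(i < p) mvprod W (fun j => if j == i then N (X j) else X j) }.

Definition underline_form (uN : W -> W) : vform (mvspace W) := fun xs =>
  if xs is [:: (_, P)] then uN P else 0.

Definition l1 (sn : W -> W -> W) (pi : W) : vform (mvspace W) := fun xs =>
  if xs is [:: (_, P)] then sn pi P else 0.

(* The label d is the degree p - 2 of a p-vector P. *)
Definition l2 (sn : W -> W -> W) : vform (mvspace W) := fun xs =>
  if xs is [:: (d, P); (_, Q)] then psign K (d + 1) *: (sn P Q : mvspace W)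
  else 0.

Definition assoc_Linfty (sn : W -> W -> W) (pi : W) : vform (mvspace W) :=
  add_vform (l1 sn pi) (l2 sn).

Definition poisson (sn : W -> W -> W) (pi : W) : Prop :=
  mvect 2 pi /\ sn pi pi = 0.

End Schouten.

Definition is_piN (C : comNzRingType) (A : vbundle C) (W : exteriorAlgebra A)
    (N : A -> A) (pi piN : W) : Prop :=
  mvect 2 piN /\
  forall a b : {linear A -> C^o}, mvpair a b piN = b (N (sharp pi a)).

Section PoissonNijenhuis.
Variables (K : fieldType) (C : comAlgType K) (A : vbundle C).
Variable W : exteriorAlgebra A.

Definition transpose (N : {linear A -> A}) (a : {linear A -> C^o}) :
  {linear A -> C^o} := a \o N.

Definition koszul_bracket (mu : anchored_bracket A) (pi : W)
    (a b : {linear A -> C^o}) (X : A) : C :=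
  lieA mu (sharp pi a) b X - lieA mu (sharp pi b) a X
  - dA0 mu (mvpair a b pi) X.

Record is_poisson_nijenhuis (mu : anchored_bracket A) (sn : W -> W -> W)
    (pi : W) (N : {linear A -> A}) : Prop := IsPoissonNijenhuis {
  pn_nijenhuis : nijenhuis mu N;
  pn_poisson : poisson sn pi;
  pn_sharp : forall a, N (sharp pi a) = sharp pi (transpose N a);
  (* the value at X of N^* {a,b} is {a,b} (N X) *)
  pn_concomitant : forall a b X,
    koszul_bracket mu pi (transpose N a) b X
    + koszul_bracket mu pi a (transpose N b) X
    - koszul_bracket mu pi a b (N X)
    = koszul_bracket (deform mu N) pi a b X }.

End PoissonNijenhuis.

(* Main.v *)
(* The Richardson-Nijenhuis bracket with the unary form uN is a derivation, so
   once nuN := [uN, nu] satisfies [nuN, nuN] = 0, bracketing [nu, nu] = 0 twice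
   with uN gives [nu, [uN, nuN]] = 0, the weak Nijenhuis condition.

   That nuN is an L-infinity structure is seen by identifying it.  Derivations
   and biderivations of the exterior algebra are determined by their values on
   functions and sections; hence the Schouten bracket of mu^N is
   [uN P, Q] + [P, uN Q] - uN [P, Q], and the graded Jacobi identity reduces to
   the Lie algebroid axioms.  Since
     {a,b}_pi (X) = rho(pi# a)(b X) - rho(pi# b)(a X) + <[X, pi], a /\ b>
   for any Lie algebroid structure, the concomitant condition amounts to
   uN [X, pi] = [N X, pi] + [X, pi_N].  Together with uN pi = 2 pi_N this yields
   [pi, -]_N = [pi_N, -], so that nuN is the structure of (-pi, mu^N).

   The Poisson identities for pi_N come from N being Nijenhuis: the exterior
   power of 1 + tN maps the bracket [-,-] + t [-,-]_N to [-,-], and it sends pi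
   to pi + 2t pi_N + t^2 pi', where pi' is the image of pi under the exterior
   square of N.  Comparing the values t = 1, -1, 2 in
   [pi + 2t pi_N + t^2 pi', pi + 2t pi_N + t^2 pi'] = 0 gives
   [pi_N, pi_N] = [pi_N, pi'] = 0. *)

Require Import Defs.
From HB Require Import structures.
From mathcomp Require Import all_boot all_order all_fingroup all_algebra.
From mathcomp Require Import zify ring.

Set Implicit Arguments.
Unset Strict Implicit.
Unset Printing Implicit Defensive.

Import GRing.Theory Num.Theory.
Local Open Scope ring_scope.

(* [ring] does not apply in modules: [zmod] decides equalities between Z-linear
   combinations of arbitrary terms, by reflection. *)
Inductive zexp := ZVar of nat | ZZero | ZAdd of zexp & zexp | ZOpp of zexp.

Fixpoint zeval (V : zmodType) (s : seq V) (e : zexp) : V :=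
  match e with
  | ZVar i => s`_i
  | ZZero => 0
  | ZAdd e f => zeval s e + zeval s f
  | ZOpp e => - zeval s e
  end.

Fixpoint zcoef (e : zexp) (i : nat) : int :=
  match e with
  | ZVar j => (i == j)%:R
  | ZZero => 0
  | ZAdd e f => zcoef e i + zcoef f i
  | ZOpp e => - zcoef e i
  end.

Fixpoint zbound (n : nat) (e : zexp) : bool :=
  match e with
  | ZVar j => (j < n)%N
  | ZZero => true
  | ZAdd e f => zbound n e && zbound n f
  | ZOpp e => zbound n e
  end.

Lemma zevalE (V : zmodType) (s : seq V) e : zbound (size s) e ->
  zeval s e = \sum_(i < size s) s`_i *~ zcoef e i.
Proof.
elim: e => [j|||] /=.
- move=> lt_j; rewrite (bigD1 (Ordinal lt_j)) //= eqxx big1 ?addr0 // => i.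
  by rewrite -val_eqE /= => /negPf ->.
- by rewrite big1.
- move=> e IHe f IHf /andP[/IHe -> /IHf ->]; rewrite -big_split /=.
  by apply: eq_bigr => i _; rewrite mulrzDr.
- by move=> e IH /IH ->; rewrite -sumrN; apply: eq_bigr => i _; rewrite mulrNz.
Qed.

Lemma zmod_reflect (V : zmodType) (s : seq V) e f :
  [&& zbound (size s) e, zbound (size s) f
    & all (fun i => zcoef e i == zcoef f i) (iota 0 (size s))] ->
  zeval s e = zeval s f.
Proof.
case/and3P=> he hf /allP hef; rewrite !zevalE //; apply: eq_bigr => i _.
by rewrite (eqP (hef i _)) // mem_iota /=.
Qed.

Ltac zlookup_syn x s :=
  match s with
  | x :: _ => constr:(0%N)
  | _ :: ?t => let n := zlookup_syn x t in constr:(n.+1)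
  end.

Ltac zlookup_conv x s :=
  match s with
  | ?y :: _ => let _ := match goal with _ => unify x y end in constr:(0%N)
  | _ :: ?t => let n := zlookup_conv x t in constr:(n.+1)
  end.

(** Atoms are compared syntactically first; unification then identifies those that are merely
    convertible. *)
Ltac zlookup x s :=
  match s with
  | _ => zlookup_syn x s
  | _ => zlookup_conv x s
  end.

Ltac zatoms e s :=
  lazymatch e with
  | (?a + ?b)%R => let s := zatoms a s in zatoms b s
  | (- ?a)%R => zatoms a s
  | (?a *+ 2)%R => zatoms a s
  | 0%R => s
  | ?x => match s with
          | _ => let _ := zlookup x s in s
          | _ => constr:(x :: s)
          end
  end.

Ltac zreify e s :=
  lazymatch e with
  | (?a + ?b)%R => let a := zreify a s in let b := zreify b s in constr:(ZAdd a b)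
  | (- ?a)%R => let a := zreify a s in constr:(ZOpp a)
  | (?a *+ 2)%R => let a := zreify a s in constr:(ZAdd a a)
  | 0%R => constr:(ZZero)
  | ?x => let n := zlookup x s in constr:(ZVar n)
  end.

Ltac zmod :=
  lazymatch goal with
  | |- @eq ?V ?l ?r =>
    let s := zatoms l (@nil V) in let s := zatoms r s in
    let l' := zreify l s in let r' := zreify r s in
    exact: (@zmod_reflect _ s l' r' (erefl true))
  end.

(** When a goal [a = b] follows from several equations, these are first combined into one equation
    [c = d]; the remaining identity [a - b = c - d] is left to [zmod]. *)
Lemma eq_lincomb (V : zmodType) (a b c d : V) : c = d -> a - b = c - d -> a = b.
Proof. by move=> -> /eqP; rewrite subrr subr_eq0 => /eqP. Qed.

(** * Parities of degrees and the signs they determine *)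

Definition podd (d : int) : bool := odd `|d|%N.

Lemma poddD a b : podd (a + b) = podd a (+) podd b.
Proof. rewrite /podd; lia. Qed.

Lemma poddN a : podd (- a) = podd a.
Proof. by rewrite /podd abszN. Qed.

Lemma poddM a b : podd (a * b) = podd a && podd b.
Proof. by rewrite /podd abszM oddM. Qed.

Lemma psign_podd (R : nzRingType) d : psign R d = if podd d then -1 else 1.
Proof. by rewrite /psign -signr_odd -/(podd d); case: (podd d). Qed.

(** * Forms concentrated in arities 1 and 2 *)

Section LowArity.
Variables (K : fieldType) (E : gradedSpace K).
Implicit Types (F G : vform E) (x y z : int * E).

Lemma enum_ord3 : enum 'I_3 = [:: ord0; @Ordinal 3 1 isT; @Ordinal 3 2 isT].
Proof. by apply: (inj_map val_inj); rewrite val_enum_ord. Qed.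

Lemma enum_ord2 : enum 'I_2 = [:: ord0; @Ordinal 2 1 isT].
Proof. by apply: (inj_map val_inj); rewrite val_enum_ord. Qed.

(* The last three fields are what remains of linearity when the arguments are
   not known to be homogeneous. *)
Record low_form F : Prop := LowForm {
  low_nil : F [::] = 0;
  low_big : forall xs, (2 < size xs)%N -> F xs = 0;
  low_zero : forall d, F [:: (d, 0)] = 0;
  low_zerol : forall d y, F [:: (d, 0); y] = 0;
  low_zeror : forall d y, F [:: y; (d, 0)] = 0 }.

Lemma low_head F d xs : low_form F -> F ((d, 0) :: xs) = 0.
Proof.
move=> hF; case: xs => [|y [|z xs]]; first exact: low_zero.
  exact: low_zerol.
exact: low_big.
Qed.

Definition ins_term c F G (xs : seq (int * E)) (k : nat) (s : 'S_(size xs)) : E :=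
  koszul K (fun i => (tnth (in_tuple xs) i).1) s *:
    G ((degsum (take k (permlist s)) + c, F (take k (permlist s)))
       :: drop k (permlist s)).

Lemma insertionE c F G xs : insertion c F G xs =
  \sum_(k < (size xs).+1) \sum_(s : 'S_(size xs) | unshuffle k s)
    ins_term c F G k s.
Proof. by []. Qed.

Lemma size_permlist (xs : seq (int * E)) s : size (@permlist K E xs s) = size xs.
Proof. by rewrite size_map size_enum_ord. Qed.

Lemma ins_term0 c F G xs s : low_form F -> low_form G ->
  @ins_term c F G xs 0 s = 0.
Proof.
by move=> hF hG; rewrite /ins_term take0 low_nil // low_head // scaler0.
Qed.

(** The inner form receives [k] arguments and the outer one [size xs - k + 1]; a nonzero term needs
    both numbers to be at most 2. *)
Lemma ins_term_big c F G xs k s : low_form F -> low_form G ->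
  (k <= size xs)%N -> (2 < k)%N || (k + 1 < size xs)%N ->
  @ins_term c F G xs k s = 0.
Proof.
move=> hF hG lek; rewrite /ins_term; case/orP => hk.
  rewrite (low_big hF) ?size_take_min ?size_permlist ?(minn_idPl lek) //.
  by rewrite low_head // scaler0.
rewrite (low_big hG) ?scaler0 //= size_drop size_permlist; lia.
Qed.

Lemma koszul1 n (d : 'I_n -> int) : koszul K d 1%g = 1.
Proof.
rewrite /koszul big1 // => i _; rewrite big1 // => j /andP[ij].
by rewrite !perm1 ltnNge ltnW.
Qed.

Lemma permlist1 (xs : seq (int * E)) : @permlist K E xs 1%g = xs.
Proof.
rewrite /permlist -[RHS](@map_tnth_enum _ _ (in_tuple xs)).
by apply: eq_map => i; rewrite perm1.
Qed.

Lemma sum_perm n (P : pred 'S_n) (ps : seq 'S_n) (F : 'S_n -> E) :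
  uniq ps -> (forall s, P s = (s \in ps)) ->
  \sum_(s | P s) F s = \sum_(s <- ps) F s.
Proof.
move=> ups hP; rewrite -big_filter; apply: perm_big.
by apply: uniq_perm => [||s]; rewrite ?filter_uniq ?index_enum_uniq // mem_filter
  hP mem_index_enum andbT.
Qed.

(** * Unshuffles and Koszul signs on at most three letters *)

Let i0 : 'I_2 := ord0.
Let i1 : 'I_2 := @Ordinal 2 1 isT.
Let o0 : 'I_3 := ord0.
Let o1 : 'I_3 := @Ordinal 3 1 isT.
Let o2 : 'I_3 := @Ordinal 3 2 isT.

Lemma perm2P (s t : 'S_2) : s i0 = t i0 -> s = t.
Proof.
move=> e0; have ne (u : 'S_2) : u i0 != u i1 by rewrite (inj_eq perm_inj).
have e1 : s i1 = t i1.
  apply: val_inj; move: (ne s) (ne t); rewrite e0 -!val_eqE /=.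
  move: (ltn_ord (t i0)) (ltn_ord (t i1)) (ltn_ord (s i1)) => /=; lia.
apply/permP => -[[|[|//]] h].
  by rewrite (_ : Ordinal h = i0) //; apply: val_inj.
by rewrite (_ : Ordinal h = i1) //; apply: val_inj.
Qed.

Lemma perm3P (s t : 'S_3) : s o0 = t o0 -> s o1 = t o1 -> s = t.
Proof.
move=> e0 e1; have e2 : s o2 = t o2.
  have ne (u : 'S_3) i j : i != j -> u i != u j by rewrite (inj_eq perm_inj).
  apply: val_inj; move: (ne s o0 o2 isT) (ne t o0 o2 isT) (ne s o1 o2 isT) (ne t o1 o2 isT).
  move: (ne t o0 o1 isT); rewrite e0 e1 -!val_eqE /=.
  move: (ltn_ord (t o0)) (ltn_ord (t o1)) (ltn_ord (t o2)) (ltn_ord (s o2)) => /=; lia.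
apply/permP => -[[|[|[|//]]] h].
- by rewrite (_ : Ordinal h = o0) //; apply: val_inj.
- by rewrite (_ : Ordinal h = o1) //; apply: val_inj.
- by rewrite (_ : Ordinal h = o2) //; apply: val_inj.
Qed.

Lemma unshuffle_id1 (s : 'S_1) : unshuffle 1 s = (s == 1%g).
Proof.
rewrite [s](_ : _ = 1%g); last by apply/permP => i; rewrite !ord1.
by rewrite eqxx; apply/forallP => i; apply/forallP => j; rewrite !ord1.
Qed.

Lemma unshuffle11 (s : 'S_2) : unshuffle 1 s = (s \in [:: 1%g; tperm i0 i1]).
Proof.
rewrite [LHS](_ : _ = true).
  apply/esym; rewrite !inE; case: (s i0 =P i0) => h; apply/orP.
    by left; apply/eqP/perm2P; rewrite perm1.
  right; apply/eqP/perm2P; rewrite tpermL.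
  by move: h; case: (s i0) => -[|[|//]] hh h; apply: val_inj => //; case: h; apply: val_inj.
by apply/forallP => -[[|[|//]] ?]; apply/forallP => -[[|[|//]] ?].
Qed.

Lemma unshuffle_id2 (s : 'S_2) : unshuffle 2 s = (s == 1%g).
Proof.
apply/idP/eqP => [/forallP /(_ i0) /forallP /(_ i1) /= h|->].
  apply: perm2P; rewrite perm1; apply: val_inj; move: h.
  by case: (s i0) (s i1) => -[|[|//]] ? [[|[|//]] ?].
by apply/forallP => i; apply/forallP => j; rewrite !perm1; apply/implyP => /andP[].
Qed.

(** Applied to a list [x, y, z] these give [x, y, z], then [x, z, y], then [y, z, x]: products of
    permutations act from left to right, so the last one moves the first argument to the end. *)
Lemma unshuffle21 (s : 'S_3) : unshuffle 2 s =
  (s \in [:: 1%g; tperm o1 o2; (tperm o0 o1 * tperm o0 o2)%g]).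
Proof.
apply/idP/idP => [/forallP /(_ o0) /forallP /(_ o1) /= h|].
  have ne : s o0 <> s o1 by move/perm_inj.
  have : [\/ s o0 = o0 /\ s o1 = o1, s o0 = o0 /\ s o1 = o2 | s o0 = o1 /\ s o1 = o2].
    case: (s o0) (s o1) h ne => -[|[|[|//]]] ? [[|[|[|//]]] ?] //= _ _;
    [apply: Or31 | apply: Or32 | apply: Or33]; split; exact: val_inj.
  rewrite !inE; case=> -[h0 h1]; apply/or3P; [apply: Or31 | apply: Or32 | apply: Or33];
   by apply/eqP/perm3P; rewrite ?h0 ?h1 ?perm1 ?permM ?permE //= ?permE.
rewrite !inE => /or3P[] /eqP ->; apply/forallP => -[[|[|[|//]]] ?];
  apply/forallP => -[[|[|[|//]]] ?] //; by rewrite ?perm1 ?permM ?permE //= ?permE.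
Qed.

Lemma koszul2 (d : 'I_2 -> int) (s : 'S_2) : koszul K d s =
  if (s i1 < s i0)%N then psign K (d (s i0) * d (s i1)) else 1.
Proof.
rewrite /koszul !big_ord_recl big_ord0 mulr1 [X in _ * X]big1 => [|j]; last first.
  by case: j => -[|[|//]] ?.
rewrite mulr1 big_mkcond !big_ord_recl big_ord0 /= mul1r mulr1.
by rewrite [lift ord0 ord0](_ : _ = i1) //; apply: val_inj.
Qed.

Lemma koszul3 (d : 'I_3 -> int) (s : 'S_3) : koszul K d s =
  (if (s o1 < s o0)%N then psign K (d (s o0) * d (s o1)) else 1)
  * (if (s o2 < s o0)%N then psign K (d (s o0) * d (s o2)) else 1)
  * (if (s o2 < s o1)%N then psign K (d (s o1) * d (s o2)) else 1).
Proof.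
have e1 : lift ord0 ord0 = o1 by apply: val_inj.
have e2 : lift ord0 (lift ord0 ord0) = o2 by apply: val_inj.
rewrite /koszul !big_ord_recl big_ord0 mulr1 [X in _ * (_ * X)]big1 => [|j]; last first.
  by case: j => -[|[|[|//]]] ?.
rewrite mulr1 !(big_mkcond (fun j => _ && _)) !big_ord_recl !big_ord0 /= !mul1r !mulr1.
by rewrite !e1 !e2.
Qed.

Lemma insertion0 c F G : low_form F -> low_form G -> insertion c F G [::] = 0.
Proof.
move=> hF hG; rewrite insertionE big_ord1 big1 // => s _; exact: ins_term0.
Qed.

Lemma insertion_big c F G xs : low_form F -> low_form G -> (3 < size xs)%N ->
  insertion c F G xs = 0.
Proof.
move=> hF hG hxs; rewrite insertionE big1 // => -[k hk] _ /=.
by rewrite big1 // => s _; rewrite ins_term_big //; lia.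
Qed.

Lemma insertion1 c F G x : low_form F -> low_form G ->
  insertion c F G [:: x] = G [:: (x.1 + c, F [:: x])].
Proof.
move=> hF hG; rewrite insertionE big_ord_recl big_ord1 /=.
rewrite [X in X + _]big1 ?add0r => [|s _]; last exact: ins_term0.
rewrite (eq_bigl _ _ unshuffle_id1) big_pred1_eq /ins_term koszul1 scale1r.
by rewrite permlist1 /= /degsum big_seq1.
Qed.

Lemma insertion2 c F G x y : low_form F -> low_form G ->
  insertion c F G [:: x; y] =
    G [:: (x.1 + c, F [:: x]); y]
    + psign K (x.1 * y.1) *: G [:: (y.1 + c, F [:: y]); x]
    + G [:: (x.1 + y.1 + c, F [:: x; y])].
Proof.
move=> hF hG; rewrite insertionE !big_ord_recl big_ord0 addr0 /=.
rewrite [X in X + _]big1 ?add0r => [|s _]; last exact: ins_term0.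
rewrite (eq_bigl _ _ unshuffle_id2) big_pred1_eq {2}/ins_term koszul1 scale1r.
rewrite permlist1 /= /degsum big_cons big_seq1; congr (_ + _).
rewrite (@sum_perm 2 _ _ _ _ unshuffle11); last first.
  by rewrite /= inE andbT; apply/eqP => /permP /(_ i0); rewrite perm1 tpermL.
rewrite big_cons big_seq1 /ins_term koszul1 permlist1 scale1r /=.
rewrite /degsum big_seq1 koszul2 /permlist enum_ord2 /= tpermL tpermR /=.
by rewrite big_seq1 mulrC.
Qed.

(** On three arguments only [k = 2] leaves at most two arguments to each form, with one term for
    each unshuffle of [unshuffle21]. *)
Lemma insertion3 c F G x y z : low_form F -> low_form G ->
  insertion c F G [:: x; y; z] =
    G [:: (x.1 + y.1 + c, F [:: x; y]); z]
    + psign K (y.1 * z.1) *: G [:: (x.1 + z.1 + c, F [:: x; z]); y]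
    + psign K (x.1 * y.1 + x.1 * z.1) *: G [:: (y.1 + z.1 + c, F [:: y; z]); x].
Proof.
move=> hF hG; rewrite insertionE !big_ord_recl big_ord0 addr0 /=.
rewrite [X in X + _]big1 ?add0r => [|s _]; last exact: ins_term0.
rewrite [X in X + _]big1 ?add0r => [|s _]; last exact: ins_term_big.
rewrite [X in _ + X]big1 ?addr0 => [|s _]; last exact: ins_term_big.
rewrite (@sum_perm 3 _ _ _ _ unshuffle21); last first.
  rewrite /= !inE andbT negb_or -andbA; apply/and3P; split; apply/eqP => /permP h.
  - by move: (h o1); rewrite perm1 tpermL.
  - by move: (h o0); rewrite permM perm1 tpermL !permE.
  - by move: (h o0); rewrite permM tpermL !permE.
rewrite !big_cons big_nil addr0 /ins_term koszul1 permlist1 scale1r !koszul3.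
rewrite /permlist enum_ord3 /= !permM !permE /= /degsum !big_cons !big_nil.
rewrite !addr0 !mul1r addrA; congr (_ + _ *: _ + _ *: _).
- by rewrite mulrC.
- rewrite !(tnth_nth x) /= !psign_podd poddD !poddM.
  move: (podd x.1) (podd y.1) (podd z.1) => [] [] [] /=;
    by rewrite ?mulN1r ?mul1r ?opprK.
Qed.

(** * The bracket with a unary form of degree 0 as a derivation *)

Section Derivation.
Variable U : vform E.
Hypotheses (lowU : low_form U) (symU : is_symform 0 U).
Hypothesis unaryU : forall x y, U [:: x; y] = 0.

Let der F := RN 0 1 U F.
Let app x : int * E := (x.1, U [:: x]).

Let psign0 : psign K (0 * 1) = 1. Proof. by []. Qed.

Lemma hom1 c F x : is_symform c F -> ghom x.1 x.2 -> ghom (x.1 + c) (F [:: x]).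
Proof.
by move=> hF hx; have := @symform_deg _ _ _ _ hF [:: x] (conj hx I); rewrite /degsum big_seq1.
Qed.

Lemma hom2 c F x y : is_symform c F -> ghom x.1 x.2 -> ghom y.1 y.2 ->
  ghom (x.1 + y.1 + c) (F [:: x; y]).
Proof.
move=> hF hx hy; have := @symform_deg _ _ _ _ hF [:: x; y] (conj hx (conj hy I)).
by rewrite /degsum big_cons big_seq1.
Qed.

Lemma hom_app x : ghom x.1 x.2 -> ghom (app x).1 (app x).2.
Proof. by move=> hx; rewrite -[(app x).1]addr0; exact: hom1 symU hx. Qed.

Lemma homD d (a b : E) : ghom d a -> ghom d b -> ghom d (a + b).
Proof. by move=> ha hb; rewrite -[a]scale1r; apply: ghom_lin. Qed.

Lemma homZ d k (a : E) : ghom d a -> ghom d (k *: a).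
Proof. by move=> ha; rewrite -[_ *: _]addr0; apply/ghom_lin/ghom0. Qed.

Lemma lin1 c F d (a : E) b k : is_symform c F -> ghom d a -> ghom d b ->
  F [:: (d, a + k *: b)] = F [:: (d, a)] + k *: F [:: (d, b)].
Proof.
move=> hF ha hb; rewrite addrC.
by rewrite (symform_lin hF (xs := [::]) (ys := [::])) //= addrC.
Qed.

Lemma lin2 c F d (a : E) b k y : is_symform c F -> ghom d a -> ghom d b ->
  ghom y.1 y.2 ->
  F [:: (d, a + k *: b); y] = F [:: (d, a); y] + k *: F [:: (d, b); y].
Proof.
move=> hF ha hb hy; rewrite addrC.
by rewrite (symform_lin hF (xs := [::]) (ys := [:: y])) //= addrC.
Qed.

Lemma der1 F x : low_form F ->
  der F [:: x] = F [:: app x] - U [:: (x.1 + 1, F [:: x])].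
Proof.
by move=> lF; rewrite /der /RN psign0 scale1r !insertion1 // addr0.
Qed.

Lemma der2 F x y : low_form F -> is_symform 1 F ->
  ghom x.1 x.2 -> ghom y.1 y.2 ->
  der F [:: x; y] = F [:: app x; y] + F [:: x; app y]
    - U [:: (x.1 + y.1 + 1, F [:: x; y])].
Proof.
move=> lF sF hx hy; rewrite /der /RN psign0 scale1r !insertion2 // !unaryU.
rewrite !addr0 scaler0 low_zero // !add0r addr0.
(* [insertion2] produces [F [:: app y; x]] with a Koszul sign; the symmetry of [F] moves [app y]
   back to the second slot with the same sign. *)
rewrite (symform_sym sF (xs := [::]) (ys := [::]) (s := x) (t := app y)) //=.
by split=> //; split=> //; apply: hom_app.
Qed.

Lemma low_der F : low_form F -> low_form (der F).
Proof.
move=> lF; split=> [|xs|d|d y|d y]; rewrite /der /RN psign0 scale1r.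
- by rewrite !insertion0 // subr0.
- case: xs => [|x [|y [|z [|t xs]]]] // _; last by rewrite !insertion_big // subr0.
  rewrite !insertion3 // !unaryU !(low_zerol lF) !scaler0 !addr0 subr0 //.
- by rewrite !insertion1 // !(low_zero lowU, low_zero lF) subr0.
- rewrite !insertion2 // !unaryU !(low_zero lowU, low_zero lF, low_zerol lF, low_zeror lF).
  by rewrite !scaler0 !addr0 subr0.
- rewrite !insertion2 // !unaryU !(low_zero lowU, low_zero lF, low_zerol lF, low_zeror lF).
  by rewrite !scaler0 !addr0 subr0.
Qed.

Section Pieces.
Variables F G : vform E.
Hypotheses (lowF : low_form F) (lowG : low_form G).
Hypotheses (symF : is_symform 1 F) (symG : is_symform 1 G).

Let linB d (a b c : E) : ghom d a -> ghom d b -> ghom d c ->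
  G [:: (d, a + b - c)] = G [:: (d, a)] + G [:: (d, b)] - G [:: (d, c)].
Proof.
move=> ha hb hc; rewrite -scaleN1r (lin1 _ symG) //; last exact: homD.
by rewrite -[b in LHS]scale1r (lin1 _ symG) // !scale1r scaleN1r.
Qed.

Let lin2B d (a b c : E) z : ghom d a -> ghom d b -> ghom d c -> ghom z.1 z.2 ->
  G [:: (d, a + b - c); z] = G [:: (d, a); z] + G [:: (d, b); z] - G [:: (d, c); z].
Proof.
move=> ha hb hc hz; rewrite -scaleN1r (lin2 _ symG) //; last exact: homD.
by rewrite -[b in LHS]scale1r (lin2 _ symG) // !scale1r scaleN1r.
Qed.

Let homU d (a : E) : ghom d a -> ghom d (U [:: (d, a)]).
Proof. by move=> ha; have := hom_app (x := (d, a)) ha. Qed.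

Let homF1u x : ghom x.1 x.2 -> ghom (x.1 + 1) (F [:: app x]).
Proof. by move=> hx; apply: (hom1 (x := app x) symF); apply: hom_app. Qed.

Let homF2 x y : ghom x.1 x.2 -> ghom y.1 y.2 ->
  [/\ ghom (x.1 + y.1 + 1) (F [:: x; y]), ghom (x.1 + y.1 + 1) (F [:: app x; y])
    & ghom (x.1 + y.1 + 1) (F [:: x; app y])].
Proof.
move=> hx hy; split; [exact: hom2|apply: (hom2 (x := app x) symF)|
  apply: (hom2 (y := app y) symF)] => //; exact: hom_app.
Qed.

(** Leibniz rule for the composition of the unary parts: the term in which [U] stands between [F]
    and [G] occurs in both summands with opposite signs. The next three lemmas do the same for the
    other arities of [F] and [G]. *)
Lemma der_comp11 x : ghom x.1 x.2 ->
  G [:: (x.1 + 1, der F [:: x])] + der G [:: (x.1 + 1, F [:: x])]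
  = G [:: (x.1 + 1, F [:: app x])]
    - U [:: (x.1 + 1 + 1, G [:: (x.1 + 1, F [:: x])])].
Proof.
move=> hx; have [h1 h2] := (homF1u hx, homU (hom1 symF hx)).
(* A zero summand is added so that the three-term linearity [linB] applies; [low_zero] then removes
   its image. *)
rewrite !der1 //= -[F [:: app x]]addr0 linB //; last exact: ghom0.
by rewrite low_zero // /app /= !addr0; zmod.
Qed.

Lemma der_comp12 x y : ghom x.1 x.2 -> ghom y.1 y.2 ->
  G [:: (x.1 + 1, der F [:: x]); y] + der G [:: (x.1 + 1, F [:: x]); y]
  = G [:: (x.1 + 1, F [:: app x]); y] + G [:: (x.1 + 1, F [:: x]); app y]
    - U [:: (x.1 + y.1 + 1 + 1, G [:: (x.1 + 1, F [:: x]); y])].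
Proof.
move=> hx hy; have [h1 h2] := (homF1u hx, homU (hom1 symF hx)).
rewrite der1 // der2 //=; last exact: hom1.
rewrite -[F [:: app x]]addr0 lin2B //; last exact: ghom0.
rewrite (_ : x.1 + 1 + y.1 = x.1 + y.1 + 1); last by ring.
by rewrite low_zerol // /app /= !addr0; zmod.
Qed.

Lemma der_comp21 x y : ghom x.1 x.2 -> ghom y.1 y.2 ->
  G [:: (x.1 + y.1 + 1, der F [:: x; y])] + der G [:: (x.1 + y.1 + 1, F [:: x; y])]
  = G [:: (x.1 + y.1 + 1, F [:: app x; y])] + G [:: (x.1 + y.1 + 1, F [:: x; app y])]
    - U [:: (x.1 + y.1 + 1 + 1, G [:: (x.1 + y.1 + 1, F [:: x; y])])].
Proof.
move=> hx hy; have [h1 h2 h3] := homF2 hx hy.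
by rewrite der1 // der2 //= linB //; [rewrite /app /=; zmod | exact: homU].
Qed.

Lemma der_comp22 x y z : ghom x.1 x.2 -> ghom y.1 y.2 -> ghom z.1 z.2 ->
  G [:: (x.1 + y.1 + 1, der F [:: x; y]); z]
    + der G [:: (x.1 + y.1 + 1, F [:: x; y]); z]
  = G [:: (x.1 + y.1 + 1, F [:: app x; y]); z]
    + G [:: (x.1 + y.1 + 1, F [:: x; app y]); z]
    + G [:: (x.1 + y.1 + 1, F [:: x; y]); app z]
    - U [:: (x.1 + y.1 + z.1 + 1 + 1, G [:: (x.1 + y.1 + 1, F [:: x; y]); z])].
Proof.
move=> hx hy hz; have [h1 h2 h3] := homF2 hx hy.
rewrite !der2 //= lin2B //; last exact: homU.
rewrite (_ : x.1 + y.1 + 1 + z.1 = x.1 + y.1 + z.1 + 1); last by ring.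
by rewrite /app /=; zmod.
Qed.

Let homG d e (a : E) z : e = d + z.1 + 1 -> ghom d a -> ghom z.1 z.2 ->
  ghom e (G [:: (d, a); z]).
Proof. move=> -> ha hz; exact: (hom2 (x := (d, a)) symG). Qed.

Lemma hom_ins1 x : ghom x.1 x.2 -> ghom (x.1 + 1 + 1) (insertion 1 F G [:: x]).
Proof.
by move=> hx; rewrite insertion1 //; apply: (hom1 (x := (_, _)) symG); apply: hom1.
Qed.

Let hom_terms2 x y (e := x.1 + y.1 + 1 + 1) : ghom x.1 x.2 -> ghom y.1 y.2 ->
  [/\ ghom e (G [:: (x.1 + 1, F [:: x]); y]), ghom e (G [:: (y.1 + 1, F [:: y]); x])
    & ghom e (G [:: (x.1 + y.1 + 1, F [:: x; y])])].
Proof.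
move=> hx hy; split.
- by apply: homG => //; [rewrite /e; ring | apply: hom1].
- by apply: homG => //; [rewrite /e; ring | apply: hom1].
- by apply: (hom1 (x := (_, _)) symG); apply: hom2.
Qed.

Let hom_terms3 x y z (e := x.1 + y.1 + z.1 + 1 + 1) :
  ghom x.1 x.2 -> ghom y.1 y.2 -> ghom z.1 z.2 ->
  [/\ ghom e (G [:: (x.1 + y.1 + 1, F [:: x; y]); z]),
      ghom e (G [:: (x.1 + z.1 + 1, F [:: x; z]); y])
    & ghom e (G [:: (y.1 + z.1 + 1, F [:: y; z]); x])].
Proof.
by move=> hx hy hz; split; apply: homG => //; rewrite /e; try ring; apply: hom2.
Qed.

Lemma hom_ins2 x y : ghom x.1 x.2 -> ghom y.1 y.2 ->
  ghom (x.1 + y.1 + 1 + 1) (insertion 1 F G [:: x; y]).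
Proof.
move=> hx hy; have [h1 h2 h3] := hom_terms2 hx hy.
by rewrite insertion2 //; do 2 apply: homD => //; apply: homZ.
Qed.

Lemma hom_ins3 x y z : ghom x.1 x.2 -> ghom y.1 y.2 -> ghom z.1 z.2 ->
  ghom (x.1 + y.1 + z.1 + 1 + 1) (insertion 1 F G [:: x; y; z]).
Proof.
move=> hx hy hz; have [h1 h2 h3] := hom_terms3 hx hy hz.
by rewrite insertion3 //; do 2 (apply: homD; last by apply: homZ).
Qed.

Lemma ins_der1 x : ghom x.1 x.2 ->
  insertion 1 (der F) G [:: x] + insertion 1 F (der G) [:: x]
  = insertion 1 F G [:: app x] - U [:: (x.1 + 1 + 1, insertion 1 F G [:: x])].
Proof.
move=> hx; have [lF lG] := (low_der lowF, low_der lowG).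
by rewrite !insertion1 //; apply: der_comp11.
Qed.

Lemma ins_der2 x y : ghom x.1 x.2 -> ghom y.1 y.2 ->
  insertion 1 (der F) G [:: x; y] + insertion 1 F (der G) [:: x; y]
  = insertion 1 F G [:: app x; y] + insertion 1 F G [:: x; app y]
    - U [:: (x.1 + y.1 + 1 + 1, insertion 1 F G [:: x; y])].
Proof.
move=> hx hy; have [lF lG] := (low_der lowF, low_der lowG).
have [h1 h2 h3] := hom_terms2 hx hy.
rewrite !insertion2 //= -[G [:: (x.1 + y.1 + 1, F [:: x; y])] in RHS]scale1r.
rewrite !(lin1 _ symU) //; last by apply: homD => //; apply: homZ.
have A := der_comp12 hx hy; have B := der_comp12 hy hx; have D := der_comp21 hx hy.
rewrite [y.1 + x.1]addrC in B.
(* Both brackets become variables, hence atoms for [zmod]. The Leibniz rules are then summed with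
   the Koszul signs of [insertion2]. *)
move: (der F) (der G) lF lG A B D => dF dG _ _ A B D.
have := congr2 +%R (congr2 +%R A (congr1 ( *:%R (psign K (x.1 * y.1))) B)) D.
rewrite /= !(scalerDr, scalerN, scale1r) => e; apply: eq_lincomb e _; zmod.
Qed.

Lemma ins_der3 x y z : ghom x.1 x.2 -> ghom y.1 y.2 -> ghom z.1 z.2 ->
  insertion 1 (der F) G [:: x; y; z] + insertion 1 F (der G) [:: x; y; z]
  = insertion 1 F G [:: app x; y; z] + insertion 1 F G [:: x; app y; z]
    + insertion 1 F G [:: x; y; app z]
    - U [:: (x.1 + y.1 + z.1 + 1 + 1, insertion 1 F G [:: x; y; z])].
Proof.
move=> hx hy hz; have [lF lG] := (low_der lowF, low_der lowG).
have [h1 h2 h3] := hom_terms3 hx hy hz.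
rewrite !insertion3 //= !(lin1 _ symU) //; last by apply: homD => //; apply: homZ.
have A := der_comp22 hx hy hz; have B := der_comp22 hx hz hy.
have D := der_comp22 hy hz hx.
rewrite (_ : x.1 + z.1 + y.1 = x.1 + y.1 + z.1) in B; last by ring.
rewrite (_ : y.1 + z.1 + x.1 = x.1 + y.1 + z.1) in D; last by ring.
move: (der F) (der G) lF lG A B D => dF dG _ _ A B D.
have := congr2 +%R (congr2 +%R A (congr1 ( *:%R (psign K (y.1 * z.1))) B))
  (congr1 ( *:%R (psign K (x.1 * y.1 + x.1 * z.1))) D).
rewrite /= !(scalerDr, scalerN) => e; apply: eq_lincomb e _; zmod.
Qed.

End Pieces.

Lemma RN11E F G xs : RN 1 1 F G xs = insertion 1 F G xs + insertion 1 G F xs.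
Proof. by rewrite /RN psign_podd /= scaleN1r opprK. Qed.

(** In degree 1 the bracket is the sum of the two insertions. Adding the Leibniz rules for both
    orders, the right-hand sides cancel, because the hypothesis makes one insertion the opposite of
    the other. *)
Lemma RN_der F G : low_form F -> low_form G -> is_symform 1 F -> is_symform 1 G ->
  eq_vform (RN 1 1 F G) (fun=> 0) ->
  forall xs, homlist xs -> RN 1 1 (der F) G xs + RN 1 1 F (der G) xs = 0.
Proof.
move=> lF lG sF sG FG0.
have [ldF ldG] := (low_der lF, low_der lG).
have FG xs : homlist xs -> insertion 1 F G xs = - insertion 1 G F xs.
  by move=> hxs; apply/eqP; rewrite -addr_eq0 -RN11E FG0.
have U0 d (a : E) : ghom d a -> U [:: (d, - a)] = - U [:: (d, a)].
  move=> ha; rewrite -[- a]add0r -scaleN1r (lin1 _ symU) //; last exact: ghom0.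
  by rewrite low_zero // add0r scaleN1r.
case=> [|x [|y [|z [|t xs]]]] /= hxs; rewrite !RN11E.
- by rewrite !insertion0 // !addr0.
- case: hxs => hx _; have hu := hom_app hx.
  have := congr2 +%R (ins_der1 lF lG sF sG hx) (ins_der1 lG lF sG sF hx).
  rewrite !FG /= ?U0 //; last exact: hom_ins1.
  by move=> e; apply: eq_lincomb e _; zmod.
- case: hxs => hx [hy _]; have [hu hv] := (hom_app hx, hom_app hy).
  have := congr2 +%R (ins_der2 lF lG sF sG hx hy) (ins_der2 lG lF sG sF hx hy).
  rewrite !FG /= ?U0 //; last exact: hom_ins2.
  by move=> e; apply: eq_lincomb e _; zmod.
- case: hxs => hx [hy [hz _]]; have [hu hv hw] := And3 (hom_app hx) (hom_app hy) (hom_app hz).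
  have := congr2 +%R (ins_der3 lF lG sF sG hx hy hz) (ins_der3 lG lF sG sF hx hy hz).
  rewrite !FG /= ?U0 //; last exact: hom_ins3.
  by move=> e; apply: eq_lincomb e _; zmod.
- by rewrite !insertion_big // !addr0.
Qed.

End Derivation.
End LowArity.

(** * Multivectors and the Schouten bracket *)

Section Generators.
Variables (C : comNzRingType) (A : lmodType C) (W : exteriorAlgebra A).
Local Notation iota := (ext_in W).

Lemma mvprodS n (X : 'I_n.+1 -> A) :
  mvprod W X = iota (X ord0) * mvprod W (fun i => X (lift ord0 i)).
Proof. by rewrite /mvprod big_ord_recl. Qed.

Definition cons_fun n (X : A) (Y : 'I_n -> A) (i : 'I_n.+1) : A :=
  if unlift ord0 i is Some j then Y j else X.

Lemma mvprod_cons n X (Y : 'I_n -> A) :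
  mvprod W (cons_fun X Y) = iota X * mvprod W Y.
Proof.
rewrite mvprodS /cons_fun unlift_none; congr (_ * _).
by apply: eq_bigr => i _; rewrite liftK.
Qed.

Lemma mvect_natD n (P Q : W) : mvect_nat n P -> mvect_nat n Q -> mvect_nat n (P + Q).
Proof. by move=> hP hQ; rewrite -[P]scale1r; apply: (@mvect_lin _ _ _ n). Qed.

Lemma mvprod_mvect n (X : 'I_n -> A) : mvect_nat n (mvprod W X).
Proof. by exists [:: (1, X)]; rewrite big_seq1 scale1r. Qed.

Lemma mvect_natS n X (P : W) : mvect_nat n P -> mvect_nat n.+1 (iota X * P).
Proof.
case=> s ->; exists [seq (t.1, cons_fun X t.2) | t <- s].
rewrite big_map mulr_sumr; apply: eq_bigr => t _.
by rewrite mvprod_cons scalerAr.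
Qed.

Lemma mvect_scalar f : mvect_nat 0 (f%:A : W).
Proof. by exists [:: (f, fun i : 'I_0 => 0)]; rewrite big_seq1 /mvprod big_ord0. Qed.

Lemma mvect_vector X : mvect_nat 1 (iota X).
Proof. by have := mvect_natS X (mvect_scalar 1); rewrite scale1r mulr1. Qed.

(** The coefficient of a monomial is absorbed into its first vector factor, so that only functions
    and left products by a vector are left to treat. *)
Lemma mvect_nat_ind (Pr : nat -> W -> Prop) :
  (forall n, Pr n 0) ->
  (forall n P Q, Pr n P -> Pr n Q -> Pr n (P + Q)) ->
  (forall f, Pr 0 f%:A) ->
  (forall n X P, mvect_nat n P -> Pr n P -> Pr n.+1 (iota X * P)) ->
  forall n P, mvect_nat n P -> Pr n P.
Proof.
move=> Pr0 PrD Prf PrX n _ [s ->]; elim: s => [|[f X] s IHs].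
  by rewrite big_nil; apply: Pr0.
rewrite big_cons /=; apply: PrD IHs => {s}.
elim: n f X => [|n IHn] f X; first by rewrite /mvprod big_ord0; apply: Prf.
rewrite mvprodS scalerAl -linearZ /=; apply: PrX; first exact: mvprod_mvect.
by rewrite -[mvprod _ _]scale1r; apply: IHn.
Qed.

Lemma mvectD p (P Q : W) : mvect p P -> mvect p Q -> mvect p (P + Q).
Proof. by move=> hP hQ; rewrite -[P]scale1r; apply: mvect_lin. Qed.

Lemma mvectZ p f (P : W) : mvect p P -> mvect p (f *: P).
Proof. by move=> hP; rewrite -[_ *: P]addr0; apply: mvect_lin => //; apply: mvect0. Qed.

Lemma mvectB p (P Q : W) : mvect p P -> mvect p Q -> mvect p (P - Q).
Proof. by move=> hP hQ; rewrite -scaleN1r; apply/mvectD/mvectZ. Qed.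

Lemma mvectM p q (P Q : W) : mvect p P -> mvect q Q -> mvect (p + q) (P * Q).
Proof.
case: p => [p|p] hP; last by move=> _; rewrite hP mul0r; apply: mvect0.
case: q => [q|q] hQ; last by rewrite hQ mulr0; apply: mvect0.
rewrite -PoszD; elim/mvect_nat_ind: p P / hP => [n|n P R hP hR|f|n X P _ IH].
- by rewrite mul0r; apply: mvect0.
- by rewrite mulrDl; apply: mvectD.
- by rewrite mulr_algl; apply: mvectZ.
- by rewrite -mulrA addSn; apply: mvect_natS.
Qed.

Lemma bivector_sum (P : W) : mvect 2 P ->
  exists s : seq (A * A), P = \sum_(t <- s) iota t.1 * iota t.2.
Proof.
case=> s ->; exists [seq (t.1 *: t.2 ord0, t.2 ord_max) | t <- s].
rewrite big_map; apply: eq_bigr => t _.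
rewrite mvprodS /mvprod big_ord1 scalerAl -linearZ /=.
by rewrite (_ : lift ord0 ord0 = ord_max) //; apply: val_inj.
Qed.

Definition is_gen (n : nat) (P : W) : Prop :=
  (n = 0 /\ exists f, P = f%:A) \/ (n = 1 /\ exists X, P = iota X).

Lemma gen_mvect n P : is_gen n P -> mvect_nat n P.
Proof.
by case=> -[-> [x ->]]; [apply: mvect_scalar | apply: mvect_vector].
Qed.

Lemma derivation_eq0 (D : W -> W) :
  (forall P Q, D (P + Q) = D P + D Q) ->
  (forall q X Q, mvect_nat q Q -> D (iota X) = 0 -> D Q = 0 -> D (iota X * Q) = 0) ->
  (forall n g, is_gen n g -> D g = 0) ->
  forall q Q, mvect_nat q Q -> D Q = 0.
Proof.
move=> DD DM Dg.
apply: (@mvect_nat_ind (fun _ Q => D Q = 0)) => [_|_ P Q hP hQ|f|n X P hP IH].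
- by apply: (addrI (D 0)); rewrite -DD !addr0.
- by rewrite DD hP hQ addr0.
- by apply: (Dg 0); left; split=> //; exists f.
- by apply: (DM n) => //; apply: (Dg 1%N); right; split=> //; exists X.
Qed.

(** Being a derivation in the second slot reduces that slot to generators; skew-symmetry then
    exchanges the slots, and the same reduction applies to the other argument. It is meant for the
    difference of two brackets. *)
Lemma biderivation_eq0 (E : W -> W -> W) :
  (forall P Q S, E P (Q + S) = E P Q + E P S) ->
  (forall p q P Q, mvect_nat p P -> mvect_nat q Q -> E P Q = 0 -> E Q P = 0) ->
  (forall p q P X Q, mvect_nat p P -> mvect_nat q Q ->
     E P (iota X) = 0 -> E P Q = 0 -> E P (iota X * Q) = 0) ->
  (forall f g : C, E f%:A g%:A = 0) ->
  (forall X f, E (iota X) f%:A = 0) ->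
  (forall X Y, E (iota X) (iota Y) = 0) ->
  forall p q P Q, mvect_nat p P -> mvect_nat q Q -> E P Q = 0.
Proof.
move=> ED Esk EM Eff EXf EXX.
have Eder p P : mvect_nat p P -> (forall n g, is_gen n g -> E P g = 0) ->
    forall q Q, mvect_nat q Q -> E P Q = 0.
  by move=> hP hg; apply: derivation_eq0 => // q X Q; apply: EM hP.
move=> p q P Q hP; apply: (Eder p) => // n g hg.
apply: (Esk n p g P (gen_mvect hg) hP).
apply: (Eder n g (gen_mvect hg) _ p P hP).
move=> m h; case: hg => -[_ [x ->]]; case=> -[_ [y ->]] //.
exact: (Esk 1%N 0 _ _ (mvect_vector y) (mvect_scalar x)).
Qed.

End Generators.

(** * Schouten calculus and the graded Jacobi identity *)

Section SchoutenCalculus.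
Variables (K : fieldType) (C : comAlgType K) (A : lmodType C).
Variables (W : exteriorAlgebra A) (mu : anchored_bracket A) (sn : W -> W -> W).
Hypothesis snP : is_schouten mu sn.
Local Notation iota := (ext_in W).

Lemma snDl P Q S : sn (P + Q) S = sn P S + sn Q S.
Proof. by have := sn_linl snP 1 P Q S; rewrite !scale1r. Qed.

Lemma snDr P Q S : sn S (P + Q) = sn S P + sn S Q.
Proof. by have := sn_linr snP 1 P Q S; rewrite !scale1r. Qed.

Lemma sn0l S : sn 0 S = 0.
Proof. by apply: (addrI (sn 0 S)); rewrite -snDl !addr0. Qed.

Lemma sn0r S : sn S 0 = 0.
Proof. by apply: (addrI (sn S 0)); rewrite -snDr !addr0. Qed.

Lemma snZl (k : K) P S : sn (k%:A *: P) S = k%:A *: sn P S.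
Proof. by have := sn_linl snP k P 0 S; rewrite sn0l !addr0. Qed.

Lemma snZr (k : K) P S : sn S (k%:A *: P) = k%:A *: sn S P.
Proof. by have := sn_linr snP k P 0 S; rewrite sn0r !addr0. Qed.

Lemma snNl P S : sn (- P) S = - sn P S.
Proof. by apply: (addrI (sn P S)); rewrite -snDl !subrr sn0l. Qed.

Lemma snNr P S : sn S (- P) = - sn S P.
Proof. by apply: (addrI (sn S P)); rewrite -snDr !subrr sn0r. Qed.

(** Degrees are integers here because iterated brackets have degrees such as [p + q - 1]; a
    multivector of negative degree is 0, which settles the additional cases. *)
Lemma sn_mvect p q P Q : mvect p P -> mvect q Q -> mvect (p + q - 1) (sn P Q).
Proof.
case: p => [p|p] hP; last by rewrite hP sn0l => _; apply: mvect0.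
case: q => [q|q] hQ; last by rewrite hQ sn0r; apply: mvect0.
exact: (sn_deg snP hP hQ).
Qed.

(** The bracket has degree [0 + 0 - 1], and [mvect] in a negative degree means being zero. *)
Lemma sn_scalars f g : sn f%:A g%:A = 0.
Proof.
exact: (@sn_mvect 0 0 _ _ (mvect_scalar W f) (mvect_scalar W g)).
Qed.

Lemma sn_skewZ p q P Q : mvect p P -> mvect q Q ->
  sn P Q = - (psign C ((p - 1) * (q - 1)) *: sn Q P).
Proof.
case: p => [p|p] hP; last by rewrite hP sn0l sn0r scaler0 oppr0.
case: q => [q|q] hQ; last by rewrite hQ sn0l sn0r scaler0 oppr0.
exact: (sn_skew snP hP hQ).
Qed.

Lemma sn_wedgeZ p q r P Q S : mvect p P -> mvect q Q -> mvect r S ->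
  sn P (Q * S) = sn P Q * S + psign C ((p - 1) * q) *: (Q * sn P S).
Proof.
case: p => [p|p] hP; last by rewrite hP !sn0l mul0r mulr0 scaler0 addr0.
case: q => [q|q] hQ; last by rewrite hQ sn0r !mul0r sn0r scaler0 addr0.
case: r => [r|r] hS; last by rewrite hS sn0r !mulr0 sn0r scaler0 addr0.
exact: (sn_wedge snP hP hQ hS).
Qed.

Lemma sn_signr d P Q : sn P (psign C d *: Q) = psign C d *: sn P Q.
Proof. by rewrite psign_podd; case: podd; rewrite ?scaleN1r ?scale1r ?snNr. Qed.

Definition jacobiator p q P Q S : W :=
  sn P (sn Q S) - sn (sn P Q) S - psign C ((p - 1) * (q - 1)) *: sn Q (sn P S).

Lemma jacobiator_skewl p q P Q S : mvect p P -> mvect q Q ->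
  jacobiator q p Q P S = - (psign C ((p - 1) * (q - 1)) *: jacobiator p q P Q S).
Proof.
move=> hP hQ; rewrite /jacobiator (sn_skewZ hP hQ) snNl.
rewrite (_ : (q - 1) * (p - 1) = (p - 1) * (q - 1)); last by ring.
rewrite psign_podd; case: podd => /=; rewrite ?(scaleN1r, scale1r, snNl, opprK); zmod.
Qed.

Lemma jacobiator_skewr p q r P Q S : mvect p P -> mvect q Q -> mvect r S ->
  jacobiator p r P S Q = - (psign C ((q - 1) * (r - 1)) *: jacobiator p q P Q S).
Proof.
move=> hP hQ hS; rewrite /jacobiator (sn_skewZ hS hQ).
rewrite (sn_skewZ (sn_mvect hP hS) hQ) (sn_skewZ hS (sn_mvect hP hQ)).
rewrite !psign_podd !(poddD, poddM, poddN).
move: (podd p) (podd q) (podd r) => [] [] [] /=;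
  rewrite ?(scaleN1r, scale1r, snNr, snNl, opprK); zmod.
Qed.

(** In its last argument the jacobiator is a graded derivation, since [sn P] and [sn Q] are
    derivations and the rest is their graded commutator minus [sn (sn P Q)]. *)
Lemma jacobiator_gen_wedge p q r P Q X S : mvect p P -> mvect q Q -> mvect r S ->
  jacobiator p q P Q (iota X) = 0 -> jacobiator p q P Q S = 0 ->
  jacobiator p q P Q (iota X * S) = 0.
Proof.
move=> hP hQ hS; have hX : mvect 1 (iota X) := mvect_vector W X.
have hPX := sn_mvect hP hX; have hQX := sn_mvect hQ hX.
have hPS := sn_mvect hP hS; have hQS := sn_mvect hQ hS.
rewrite /jacobiator (sn_wedgeZ hQ hX hS) (sn_wedgeZ hP hX hS).
rewrite (sn_wedgeZ (sn_mvect hP hQ) hX hS) !snDr.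
rewrite (sn_wedgeZ hP hQX hS) (sn_wedgeZ hQ hPX hS) !sn_signr.
rewrite (sn_wedgeZ hP hX hQS) (sn_wedgeZ hQ hX hPS).
rewrite !psign_podd !(poddD, poddM, poddN) => hJX hJS.
have eX := congr1 ( *%R ^~ S) hJX; have eS := congr1 ( *%R (iota X)) hJS.
(* The sign between the two Leibniz terms is the parity of [p + q]: the sum serves for even [p + q],
   the difference for odd. *)
have e1 := congr2 +%R eX eS; have e2 := congr2 (fun a b => a - b) eX eS.
move: e1 e2 => {hJX hJS eX eS} /=; move: (podd p) (podd q) => [] [] /=;
  rewrite ?(scaleN1r, scale1r) ?(mulrDl, mulrDr, mulNr, mulrN, mul0r, mulr0, opprK) => e1 e2;
  first [apply: eq_lincomb e1 _; zmod | apply: eq_lincomb e2 _; zmod].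
Qed.

Lemma jacobiator_mvect p q r P Q S : mvect p P -> mvect q Q -> mvect r S ->
  mvect (p + q + r - 2) (jacobiator p q P Q S).
Proof.
move=> hP hQ hS; rewrite /jacobiator.
apply: mvectB; [apply: mvectB|apply: mvectZ].
- have := sn_mvect hP (sn_mvect hQ hS).
  by rewrite (_ : p + (q + r - 1) - 1 = p + q + r - 2); last by ring.
- have := sn_mvect (sn_mvect hP hQ) hS.
  by rewrite (_ : p + q - 1 + r - 1 = p + q + r - 2); last by ring.
have := sn_mvect hQ (sn_mvect hP hS).
by rewrite (_ : q + (p + r - 1) - 1 = p + q + r - 2); last by ring.
Qed.

Hypothesis laP : is_lie_algebroid mu.

Lemma jacobiator_eq0 p q r P Q S :
  mvect_nat p P -> mvect_nat q Q -> mvect_nat r S -> jacobiator p q P Q S = 0.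
Proof.
have der (n m : nat) R T : mvect_nat n R -> mvect_nat m T ->
    (forall k g, is_gen k g -> jacobiator n m R T g = 0) ->
    forall k Z, mvect_nat k Z -> jacobiator n m R T Z = 0.
  move=> hR hT; apply: derivation_eq0 => [Y Z|k X Z hZ].
    by rewrite /jacobiator !snDr scalerDr; zmod.
  exact: (@jacobiator_gen_wedge n m k).
have skewl (n m : nat) R T Z : mvect_nat n R -> mvect_nat m T ->
    jacobiator n m R T Z = 0 -> jacobiator m n T R Z = 0.
  by move=> hR hT h; rewrite (@jacobiator_skewl n m) // h scaler0 oppr0.
have skewr (n m k : nat) R T Z : mvect_nat n R -> mvect_nat m T -> mvect_nat k Z ->
    jacobiator n m R T Z = 0 -> jacobiator n k R Z T = 0.
  by move=> hR hT hZ h; rewrite (@jacobiator_skewr n m k) // h scaler0 oppr0.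
have gen (n m k : nat) f g h : is_gen n f -> is_gen m g -> is_gen k h ->
    jacobiator n m f g h = 0.
  (* With at most one section among the generators, the jacobiator has negative degree and vanishes.
     Two sections and a function give the compatibility of anchor and bracket, three sections the
     Jacobi identity. *)
  move=> hf hg hh; have J0 : (n + m + k < 2)%N -> jacobiator n m f g h = 0.
    have := jacobiator_mvect (gen_mvect hf : mvect n f) (gen_mvect hg : mvect m g)
      (gen_mvect hh : mvect k h).
    by case E: (n%:Z + m%:Z + k%:Z - 2) => [l|l] //= _; lia.
  have XYf X Y a : jacobiator 1 1 (iota X) (iota Y) a%:A = 0.
    rewrite /jacobiator !(sn_anc snP, sn_lbr snP) scale1r.
    by rewrite (anc_lbr laP) scalerBl; zmod.
  case: hf J0 => -[-> [x ->]]; case: hg => -[-> [y ->]]; case: hh => -[-> [z ->]] J0;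
    try exact: J0.
  - apply: (skewl 1%N 0%N _ _ _ (mvect_vector W y) (mvect_scalar W x)).
    exact: (skewr 1%N 1%N 0%N _ _ _ (mvect_vector W y) (mvect_vector W z) (mvect_scalar W x)).
  - exact: (skewr 1%N 1%N 0%N _ _ _ (mvect_vector W x) (mvect_vector W z) (mvect_scalar W y)).
  - exact: XYf.
  rewrite /jacobiator !(sn_lbr snP) scale1r -!linearB /= (lbr_jacobi laP).
  by rewrite -addrA -opprD subrr linear0.
have gen2 (n m k : nat) f g Z : is_gen n f -> is_gen m g -> mvect_nat k Z ->
    jacobiator n m f g Z = 0.
  move=> hf hg; apply: (der n m f g (gen_mvect hf) (gen_mvect hg)) => l h.
  exact: gen.
have gen1 (n m k : nat) f Y Z : is_gen n f -> mvect_nat m Y -> mvect_nat k Z ->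
    jacobiator n m f Y Z = 0.
  move=> hf hY; apply: (der n m f Y (gen_mvect hf) hY) => l h hh.
  apply: (skewr n l m f h Y (gen_mvect hf) (gen_mvect hh) hY).
  exact: (gen2 n l m).
move=> hP hQ; apply: (der p q P Q hP hQ) => l h hh.
apply: (skewr p l q P h Q hP (gen_mvect hh) hQ).
apply: (skewl l p h P Q (gen_mvect hh) hP).
exact: (gen1 l p q).
Qed.

End SchoutenCalculus.

(** * Deformation by a Nijenhuis tensor *)

Section LieAlgebroidBracket.
Variables (K : fieldType) (C : comAlgType K) (A : lmodType C).
Variable mu : anchored_bracket A.
Hypothesis laP : is_lie_algebroid mu.

Lemma lbrDr X Y Z : lbr mu X (Y + Z) = lbr mu X Y + lbr mu X Z.
Proof. by have := lbr_linr laP X 1 Y Z; rewrite !scale1r. Qed.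

Lemma lbr0r X : lbr mu X 0 = 0.
Proof. by apply: (addrI (lbr mu X 0)); rewrite -lbrDr !addr0. Qed.

Lemma lbrNr X Y : lbr mu X (- Y) = - lbr mu X Y.
Proof. by apply: (addrI (lbr mu X Y)); rewrite -lbrDr !subrr lbr0r. Qed.

Lemma lbrZr (k : K) X Y : lbr mu X (k%:A *: Y) = k%:A *: lbr mu X Y.
Proof. by have := lbr_linr laP X k Y 0; rewrite lbr0r !addr0. Qed.

Lemma lbrDl X Y Z : lbr mu (X + Y) Z = lbr mu X Z + lbr mu Y Z.
Proof. by rewrite lbr_skew // lbrDr opprD -!(lbr_skew laP). Qed.

Lemma lbrNl X Y : lbr mu (- X) Y = - lbr mu X Y.
Proof. by rewrite lbr_skew // lbrNr -(lbr_skew laP). Qed.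

Lemma lbrZl (k : K) X Y : lbr mu (k%:A *: X) Y = k%:A *: lbr mu X Y.
Proof. by rewrite lbr_skew // lbrZr -scalerN -(lbr_skew laP). Qed.

Lemma ancDl X Y f : anc mu (X + Y) f = anc mu X f + anc mu Y f.
Proof. by have := anc_lin laP 1 X Y f; rewrite scale1r mul1r. Qed.

Lemma anc0l f : anc mu 0 f = 0.
Proof. by apply: (addrI (anc mu 0 f)); rewrite -ancDl !addr0. Qed.

Lemma ancZl g X f : anc mu (g *: X) f = g * anc mu X f.
Proof. by have := anc_lin laP g X 0 f; rewrite anc0l !addr0. Qed.

Lemma ancDr X f g : anc mu X (f + g) = anc mu X f + anc mu X g.
Proof. by have := anc_klin laP X 1 f g; rewrite !scale1r. Qed.

Lemma anc0r X : anc mu X 0 = 0.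
Proof. by apply: (addrI (anc mu X 0)); rewrite -ancDr !addr0. Qed.

Lemma ancNr X f : anc mu X (- f) = - anc mu X f.
Proof. by apply: (addrI (anc mu X f)); rewrite -ancDr !subrr anc0r. Qed.

Variable N : {linear A -> A}.
Hypothesis nijN : nijenhuis mu N.

Lemma deform_lie_algebroid : is_lie_algebroid (deform mu N).
Proof.
have N2 X Y : lbr mu (N X) (N Y)
    = N (lbr mu (N X) Y) + N (lbr mu X (N Y)) - N (N (lbr mu X Y)).
  by rewrite nijN /= linearB linearD.
split=> /=.
- move=> X k Y Z; rewrite !linearP /= !(lbr_linr laP) !linearP /=.
  by rewrite !(scalerDr, scalerN); zmod.
- move=> X Y; rewrite (lbr_skew laP (N X) Y) (lbr_skew laP X (N Y)).
  by rewrite (lbr_skew laP X Y) linearN; zmod.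
(* The Jacobi identity of the deformed bracket is the sum of the original ones with [N] on two
   arguments, minus [N] of those with [N] on one argument, plus [N] twice applied to the plain one.
   [N2] eliminates every bracket of two images of [N]. *)
- move=> X Y Z; have e1 := lbr_jacobi laP (N X) (N Y) Z.
  have e2 := lbr_jacobi laP (N X) Y (N Z).
  have e3 := lbr_jacobi laP X (N Y) (N Z).
  have e4 := congr1 N (lbr_jacobi laP (N X) Y Z).
  have e5 := congr1 N (lbr_jacobi laP X (N Y) Z).
  have e6 := congr1 N (lbr_jacobi laP X Y (N Z)).
  have e7 := congr1 (N \o N) (lbr_jacobi laP X Y Z).
  rewrite /= !N2 !(lbrDr, lbrDl, lbrNr, lbrNl, linearD, linearN, N2) /= in e1 e2 e3 e4 e5 e6 e7 *.
  have := congr2 +%R (congr2 +%R (congr2 +%R e1 e2) (congr2 +%R e3 e7))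
    (congr2 +%R (congr2 +%R (congr1 -%R e4) (congr1 -%R e5)) (congr1 -%R e6)).
  move=> e; apply: eq_lincomb e _; zmod.
- by move=> f X Y g; rewrite linearP /= anc_lin.
- by move=> X k f g; rewrite anc_klin.
- by move=> X f g; rewrite anc_der.
- move=> X Y f; rewrite -[N _]/(N (lbr (deform mu N) X Y)) -nijN.
  by rewrite anc_lbr.
- move=> X f Y; rewrite !linearZ /= !(lbr_leibniz laP) !linearD !linearZ /=.
  by rewrite !(scalerDr, scalerN); zmod.
Qed.

End LieAlgebroidBracket.

(** * The derivation extending [N], and the deformed Schouten bracket *)

Section Underline.
Variables (K : fieldType) (C : comAlgType K) (A : lmodType C).
Variables (W : exteriorAlgebra A) (N : {linear A -> A}) (uN : W -> W).
Hypothesis uNP : is_underline N uN.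
Local Notation iota := (ext_in W).

Lemma uND P Q : uN (P + Q) = uN P + uN Q.
Proof. by have := uN_lin uNP 1 P Q; rewrite !scale1r. Qed.

Lemma uN0 : uN 0 = 0.
Proof. by apply: (addrI (uN 0)); rewrite -uND !addr0. Qed.

Lemma uNN P : uN (- P) = - uN P.
Proof. by apply: (addrI (uN P)); rewrite -uND !subrr uN0. Qed.

Lemma uN_sum I (r : seq I) (F : I -> W) : uN (\sum_(i <- r) F i) = \sum_(i <- r) uN (F i).
Proof. by apply: (big_morph uN uND uN0). Qed.

Lemma uN_vector X : uN (iota X) = iota (N X).
Proof.
have := uN_prod uNP (fun _ : 'I_1 => X).
by rewrite big_ord1 /mvprod !big_ord1 eqxx.
Qed.

Lemma uN_vector_mvprod n X (Y : 'I_n -> A) :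
  uN (iota X * mvprod W Y) = iota (N X) * mvprod W Y + iota X * uN (mvprod W Y).
Proof.
rewrite -mvprod_cons (uN_prod uNP) big_ord_recl (uN_prod uNP) mulr_sumr.
congr (_ + _).
  rewrite mvprodS eqxx /cons_fun unlift_none; congr (_ * _).
  by apply: eq_bigr => i _; rewrite liftK.
apply: eq_bigr => i _; rewrite mvprodS /= /cons_fun unlift_none; congr (_ * _).
by apply: eq_bigr => j _; rewrite liftK (inj_eq lift_inj).
Qed.

(** Linearity over functions comes from absorbing [f] into the first vector; a product without
    factors is a function, which [uN] kills. *)
Lemma uN_scale_mvprod n f (Y : 'I_n -> A) : uN (f *: mvprod W Y) = f *: uN (mvprod W Y).
Proof.
case: n Y => [|n] Y.
  by rewrite /mvprod big_ord0 (uN_fun uNP) -[1]scale1r (uN_fun uNP) scaler0.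
rewrite mvprodS scalerAl -linearZ /= !uN_vector_mvprod !linearZ /=.
by rewrite scalerDr !scalerAl.
Qed.

Lemma uN_vector_mul n X Q : mvect_nat n Q ->
  uN (iota X * Q) = iota (N X) * Q + iota X * uN Q.
Proof.
case=> s ->; rewrite mulr_sumr !uN_sum !mulr_sumr -big_split /=.
apply: eq_bigr => t _; rewrite uN_scale_mvprod -!scalerAr.
by rewrite scalerAl -linearZ /= uN_vector_mvprod !linearZ /= -!scalerAl.
Qed.

Lemma uN_mvect n P : mvect_nat n P -> mvect_nat n (uN P).
Proof.
elim/mvect_nat_ind: n P / => [n|n P Q hP hQ|f|n X P hP IH].
- by rewrite uN0; exact: (mvect0 W n).
- by rewrite uND; apply: mvect_natD.
- by rewrite (uN_fun uNP); exact: (mvect0 W 0).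
- by rewrite (uN_vector_mul X hP); apply: mvect_natD; apply: mvect_natS.
Qed.

Lemma uN_mvectZ p P : mvect p P -> mvect p (uN P).
Proof. by case: p => [p|p]; [exact: uN_mvect | move=> ->; rewrite uN0]. Qed.

Lemma uN_scale n f P : mvect_nat n P -> uN (f *: P) = f *: uN P.
Proof.
case=> s ->; rewrite scaler_sumr !uN_sum scaler_sumr; apply: eq_bigr => t _.
by rewrite scalerA !uN_scale_mvprod scalerA.
Qed.

Lemma uN_mul p q P Q : mvect p P -> mvect q Q -> uN (P * Q) = uN P * Q + P * uN Q.
Proof.
case: p => [p|p] hP; last by rewrite hP uN0 !mul0r uN0 addr0.
case: q => [q|q] hQ; last by rewrite hQ uN0 !mulr0 uN0 addr0.
elim/mvect_nat_ind: p P / hP => [n|n P R hP hR|f|n X P hP IH].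
- by rewrite uN0 !mul0r uN0 addr0.
- by rewrite uND !mulrDl uND hP hR; zmod.
- by rewrite (uN_fun uNP) !mulr_algl mul0r add0r (uN_scale f hQ).
- have hPQ : mvect (n + q)%N (P * Q) by have := mvectM (hP : mvect n P) (hQ : mvect q Q).
  rewrite -!mulrA (uN_vector_mul X hPQ) (uN_vector_mul X hP) IH.
  by rewrite mulrDl mulrDr !mulrA addrA.
Qed.

Variables (mu : anchored_bracket A) (sn snN : W -> W -> W).
Hypotheses (snP : is_schouten mu sn) (snNP : is_schouten (deform mu N) snN).

(** The difference [E] of the two sides is a graded biderivation, and on functions and sections it
    vanishes by the definition of [deform]. *)
Lemma sn_deform p q P Q : mvect p P -> mvect q Q ->
  snN P Q = sn (uN P) Q + sn P (uN Q) - uN (sn P Q).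
Proof.
case: p => [p|p] hP; last by rewrite hP uN0 (sn0l snNP) !(sn0l snP) uN0 !addr0 subr0.
case: q => [q|q] hQ; last by rewrite hQ uN0 (sn0r snNP) !(sn0r snP) uN0 !addr0 subr0.
apply/eqP; rewrite -subr_eq0; apply/eqP; move: p q P Q hP hQ.
pose E P Q := snN P Q - (sn (uN P) Q + sn P (uN Q) - uN (sn P Q)).
suff: forall p q P Q, mvect_nat p P -> mvect_nat q Q -> E P Q = 0 by [].
apply: biderivation_eq0 => [P Q S|p q P Q hP hQ|p q P X Q hP hQ|f g|X f|X Y].
- by rewrite /E (snDr snNP) uND !(snDr snP) uND; zmod.
- have [hP' hQ'] := (uN_mvect hP, uN_mvect hQ).
  rewrite /E (sn_skewZ snNP (p := q) (q := p) hQ hP).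
  rewrite (sn_skewZ snP (p := q) (q := p) hQ' hP) (sn_skewZ snP (p := q) (q := p) hQ hP').
  rewrite (sn_skewZ snP (p := q) (q := p) hQ hP) psign_podd.
  case: podd => /=; rewrite ?(scaleN1r, scale1r, uNN, opprK) => e.
    by apply: eq_lincomb e _; zmod.
  by apply: eq_lincomb (congr1 -%R e) _; zmod.
- have hX : mvect 1 (iota X) := mvect_vector W X.
  have [hP' hQ'] := (uN_mvect hP, uN_mvect hQ).
  have hNX : mvect 1 (iota (N X)) := mvect_vector W (N X).
  have hPQ := sn_mvect snP (hP : mvect p P) (hQ : mvect q Q).
  have hPX := sn_mvect snP (hP : mvect p P) hX.
  rewrite /E (uN_vector_mul X hQ) uN_vector.
  rewrite (sn_wedgeZ snNP (p := p) (r := q) hP hX hQ).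
  rewrite (sn_wedgeZ snP (p := p) (r := q) hP' hX hQ) (snDr snP).
  rewrite (sn_wedgeZ snP (p := p) (r := q) hP hX hQ).
  rewrite (sn_wedgeZ snP (p := p) (r := q) hP hNX hQ).
  rewrite (sn_wedgeZ snP (p := p) (r := q) hP hX hQ') uND.
  rewrite (uN_mul hPX (hQ : mvect q Q)) mulr1 => eX eQ.
  have {eX} eX := congr1 ( *%R ^~ Q) eX; have {eQ} eQ := congr1 ( *%R (iota X)) eQ.
  rewrite /= !(mulrDl, mulrDr, mulNr, mulrN, mul0r, mulr0) in eX eQ.
  move: eX eQ; rewrite psign_podd; case: podd => /=;
    rewrite ?(scaleN1r, scale1r, uNN) (uN_mul hX hPQ) uN_vector => eX eQ.
    by have e := congr2 (fun a b => a - b) eX eQ; apply: eq_lincomb e _; zmod.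
  by have e := congr2 +%R eX eQ; apply: eq_lincomb e _; zmod.
- rewrite /E !(uN_fun uNP) (sn_scalars snP) (sn_scalars snNP).
  by rewrite (sn0l snP) (sn0r snP) uN0 addr0 !subr0.
- rewrite /E uN_vector (uN_fun uNP) !(sn_anc snP) (sn_anc snNP) (sn0r snP).
  by rewrite (uN_fun uNP) /= addr0 subr0 subrr.
- rewrite /E !uN_vector !(sn_lbr snP) (sn_lbr snNP) uN_vector /=.
  by rewrite linearB linearD subrr.
Qed.

End Underline.

(** * Exterior powers of endomorphisms *)

Section ExteriorMap.
Variables (C : comNzRingType) (A : lmodType C) (W : exteriorAlgebra A).
Variable M : {linear A -> A}.
Local Notation iota := (ext_in W).

Fact ext_map_sq X : (iota \o M) X * (iota \o M) X = 0.
Proof. exact: ext_sq. Qed.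

Definition ext_map : {lrmorphism W -> W} := ext_lift W ext_map_sq.

Lemma ext_map_vector X : ext_map (iota X) = iota (M X).
Proof. exact: ext_liftE. Qed.

Lemma ext_map_scalar (f : C) : ext_map f%:A = f%:A.
Proof. by rewrite linearZ rmorph1. Qed.

Lemma ext_map_mvect n P : mvect_nat n P -> mvect_nat n (ext_map P).
Proof.
elim/mvect_nat_ind: n P / => [n|n P Q hP hQ|f|n X P hP IH].
- by rewrite linear0; exact: (mvect0 W n).
- by rewrite linearD; apply: mvect_natD.
- by rewrite ext_map_scalar; apply: mvect_scalar.
- by rewrite rmorphM /= ext_map_vector; apply: mvect_natS.
Qed.

End ExteriorMap.

Section ExteriorMapBracket.
Variables (K : fieldType) (C : comAlgType K) (A : lmodType C).
Variables (W : exteriorAlgebra A) (N : {linear A -> A}).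
Variables (mu : anchored_bracket A) (sn snN : W -> W -> W).
Hypotheses (laP : is_lie_algebroid mu) (nijN : nijenhuis mu N).
Hypotheses (snP : is_schouten mu sn) (snNP : is_schouten (deform mu N) snN).
Local Notation iota := (ext_in W).

Definition id_plus (t : K) : {linear A -> A} := idfun \+ (t%:A : C) \*: N.

Lemma id_plusE t X : id_plus t X = X + t%:A *: N X.
Proof. by []. Qed.

(* Since 1 + tN is a Nijenhuis tensor whose deformed bracket is mu + t mu^N,
   its exterior power intertwines the Schouten brackets. *)
Lemma sn_id_plus t p q P Q : mvect_nat p P -> mvect_nat q Q ->
  sn (ext_map W (id_plus t) P) (ext_map W (id_plus t) Q)
  = ext_map W (id_plus t) (sn P Q + t%:A *: snN P Q).
Proof.
move=> hP hQ; apply/eqP; rewrite -subr_eq0; apply/eqP; move: p q P Q hP hQ.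
set phi := ext_map W (id_plus t).
pose E P Q := sn (phi P) (phi Q) - phi (sn P Q + t%:A *: snN P Q).
suff: forall p q P Q, mvect_nat p P -> mvect_nat q Q -> E P Q = 0 by [].
have phim := ext_map_mvect (W := W) (id_plus t).
apply: biderivation_eq0 => [P Q S|p q P Q hP hQ|p q P X Q hP hQ|f g|X f|X Y].
- rewrite /E (snDr snP) (snDr snNP) !linearD /= (snDr snP).
  zmod.
- have [hP' hQ'] := (phim _ _ hP, phim _ _ hQ).
  rewrite /E (sn_skewZ snNP (p := q) (q := p) hQ hP).
  rewrite (sn_skewZ snP (p := q) (q := p) hQ' hP').
  rewrite (sn_skewZ snP (p := q) (q := p) hQ hP) psign_podd.
  case: podd => /=; rewrite ?(scaleN1r, scale1r, opprK) // => e.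
  apply: eq_lincomb (congr1 -%R e) _; rewrite scalerN !linearD !linearN /=; zmod.
- have [hP' hQ'] := (phim _ _ hP, phim _ _ hQ).
  have hX : mvect 1 (iota X) := mvect_vector W X.
  have hX' : mvect 1 (phi (iota X)) := phim 1%N _ hX.
  rewrite /E rmorphM /=.
  rewrite (sn_wedgeZ snNP (p := p) (r := q) hP hX hQ).
  rewrite (sn_wedgeZ snP (p := p) (r := q) hP hX hQ).
  rewrite (sn_wedgeZ snP (p := p) (r := q) hP' hX' hQ') => eX eQ.
  have {eX} eX := congr1 ( *%R ^~ (phi Q)) eX.
  have {eQ} eQ := congr1 ( *%R (phi (iota X))) eQ.
  rewrite /= !linearD !linearZ /= !(mulNr, mulrN, scalerN, rmorphM) in eX eQ *.
  rewrite !(mulrDl, mulrDr, mulNr, mulrN, mul0r, mulr0) -?scalerAl -?scalerAr in eX eQ.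
  move: eX eQ; rewrite psign_podd -/phi; case: podd => /=;
    rewrite !(scaleN1r, scale1r, scalerN, opprK) => eX eQ.
    have e := congr2 (fun a b => a - b) eX eQ; apply: eq_lincomb e _; zmod.
  by have e := congr2 +%R eX eQ; apply: eq_lincomb e _; zmod.
- rewrite /E /phi !ext_map_scalar (sn_scalars snP) (sn_scalars snNP).
  by rewrite scaler0 addr0 linear0 subr0.
- rewrite /E /phi ext_map_scalar ext_map_vector !(sn_anc snP) (sn_anc snNP) /=.
  rewrite ?id_plusE (ancDl laP) (ancZl laP) scalerA -scalerDl ext_map_scalar.
  by rewrite subrr.
- rewrite /E /phi !ext_map_vector !(sn_lbr snP) (sn_lbr snNP) -linearZ -linearD /=.
  rewrite ext_map_vector ?id_plusE -linearB /=.
  (* The coefficient of [t^2] on the left is [[N X, N Y]]; by the Nijenhuis condition it equals [N]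
     of the deformed bracket, the corresponding coefficient on the right. *)
  rewrite !(lbrDr laP, lbrDl laP, lbrZr laP, lbrZl laP) nijN /=.
  rewrite -[RHS](linear0 iota); congr (iota _).
  rewrite [N (_ + t%:A *: _)]linearD [N (t%:A *: _)]linearZ /=.
  by set Nd := N (_ - _); rewrite !(scalerDr, scalerN); zmod.
Qed.

End ExteriorMapBracket.

(** * Bivectors and Poisson-Nijenhuis pairs *)

Section MultivectorPairing.
Variables (C : comNzRingType) (A : lmodType C) (W : exteriorAlgebra A).
Local Notation iota := (ext_in W).
Implicit Types a b : {linear A -> C^o}.

Lemma mvpairD a b (P Q : W) : mvpair a b (P + Q) = mvpair a b P + mvpair a b Q.
Proof. by have := mvpair_linear a b 1 P Q; rewrite scale1r mul1r. Qed.

Lemma mvpair0 a b : mvpair a b (0 : W) = 0.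
Proof. by apply: (addrI (mvpair a b (0 : W))); rewrite -mvpairD !addr0. Qed.

Lemma mvpairN a b (P : W) : mvpair a b (- P) = - mvpair a b P.
Proof. by apply: (addrI (mvpair a b P)); rewrite -mvpairD !subrr mvpair0. Qed.

Lemma mvpair_sum a b I (s : seq I) (F : I -> W) :
  mvpair a b (\sum_(i <- s) F i) = \sum_(i <- s) mvpair a b (F i).
Proof. exact: (big_morph _ (mvpairD a b) (mvpair0 a b)). Qed.

End MultivectorPairing.

Section BivectorPairing.
Variables (K : numFieldType) (C : comAlgType K) (A : vbundle C).
Variables (W : exteriorAlgebra A).
Local Notation iota := (ext_in W).
Implicit Types a b : {linear A -> C^o}.

(** The field [K] has characteristic zero, so [n.+1] is invertible in [C]; integer factors are
    cancelled in this way below. *)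
Lemma mulrSn_eq0 (V : lmodType C) n (v : V) : v *+ n.+1 = 0 -> v = 0.
Proof.
have e : (n.+1%:R^-1 : K)%:A * (n.+1%:R : C) = 1.
  by rewrite mulr_natr scalerMnl -[_ *+ _]mulr_natr mulVf ?pnatr_eq0 // scale1r.
by move=> h; rewrite -[v]scale1r -e -scalerA scaler_nat h scaler0.
Qed.

Lemma form_scale a f (X : A) : a (f *: X) = f * (a X : C).
Proof. exact: linearZ. Qed.

Lemma mvpair_uN a b (N : {linear A -> A}) (uN : W -> W) (P : W) :
  is_underline N uN -> mvect 2 P ->
  mvpair a b (uN P) = mvpair (transpose N a) b P + mvpair a (transpose N b) P.
Proof.
move=> uNP; case/bivector_sum => s ->.
rewrite (uN_sum uNP) !mvpair_sum -big_split /=; apply: eq_bigr => t _.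
rewrite (uN_vector_mul uNP _ (mvect_vector W _)) (uN_vector uNP) mvpairD.
rewrite !mvpair_wedge /=; ring.
Qed.

Lemma mvpair_ext_map a b (N : {linear A -> A}) (P : W) : mvect 2 P ->
  mvpair a b (ext_map W N P) = mvpair (transpose N a) (transpose N b) P.
Proof.
case/bivector_sum => s ->; rewrite linear_sum !mvpair_sum; apply: eq_bigr => t _.
by rewrite rmorphM /= !ext_map_vector !mvpair_wedge.
Qed.

Lemma bcoord_inj (X Y : A) : (forall i, bcoord i X = bcoord i Y) -> X = Y.
Proof. by move=> h; apply: (can_inj (@bembK C A)); apply/rowP. Qed.

Lemma sharp_sum a (s : seq (A * A)) :
  sharp (\sum_(t <- s) iota t.1 * iota t.2) a
  = \sum_(t <- s) ((a t.1 : C) *: t.2 - (a t.2 : C) *: t.1).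
Proof.
apply: bcoord_inj => i; rewrite sharpE; last first.
  elim/big_rec: _ => [|t P _ hP]; first exact: (mvect0 W 2%N).
  by apply: mvect_natD => //; apply: mvect_natS; apply: mvect_vector.
rewrite mvpair_sum linear_sum; apply: eq_bigr => t _.
by rewrite mvpair_wedge linearB /= !form_scale.
Qed.

(** The difference is a combination of the products of [e i] and [e j] with coefficients [m i j].
    Its pairings with coordinate forms vanish, so [m] is symmetric; the products are skew, hence
    twice the difference is 0. The [e i] generate the sections but may be dependent. *)
Lemma mvpair_inj (P Q : W) : mvect 2 P -> mvect 2 Q ->
  (forall a b, mvpair a b P = mvpair a b Q) -> P = Q.
Proof.
move=> hP hQ hPQ; apply/eqP; rewrite -subr_eq0; apply/eqP.
have {hPQ} : forall a b, mvpair a b (P - Q) = 0.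
  by move=> a b; rewrite mvpairD mvpairN hPQ subrr.
have /bivector_sum[s ->] := mvectB hP hQ => {P Q hP hQ} h0.
pose e i := bprj A (delta_mx 0 i).
pose m i j : C := \sum_(t <- s) (bcoord i t.1 : C) * bcoord j t.2.
have vE (X : A) : X = \sum_i (bcoord i X : C) *: e i.
  by rewrite -{1}[X](@bembK C A) [Y in bprj A Y]row_sum_delta linear_sum;
    apply: eq_bigr => i _; rewrite linearZ.
have eC i j : iota (e i) * iota (e j) = - (iota (e j) * iota (e i)).
  apply/eqP; rewrite -addr_eq0; apply/eqP; have := ext_sq W (e i + e j).
  by rewrite linearD /= mulrDl !mulrDr !ext_sq add0r addr0.
have mC i j : m i j = m j i.
  have := h0 (@bcoord C A i) (@bcoord C A j); rewrite mvpair_sum => hs.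
  apply/eqP; rewrite -subr_eq0 -sumrB -[X in _ == X]hs; apply/eqP.
  by apply: eq_bigr => t _; rewrite mvpair_wedge; congr (_ - _); apply: mulrC.
set P := \sum_(t <- s) _; have PE : P = \sum_i \sum_j m i j *: (iota (e i) * iota (e j)).
  transitivity (\sum_i \sum_j \sum_(t <- s)
      ((bcoord i t.1 : C) * bcoord j t.2) *: (iota (e i) * iota (e j))); last first.
    by do 2 (apply: eq_bigr => ? _); rewrite scaler_suml.
  under eq_bigr do rewrite exchange_big; rewrite exchange_big /=.
  apply: eq_bigr => t _; rewrite {1}[t.1]vE {1}[t.2]vE !linear_sum mulr_suml.
  apply: eq_bigr => i _; rewrite mulr_sumr; apply: eq_bigr => j _.
  by rewrite !linearZ /= -scalerAl -scalerAr scalerA.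
apply: (@mulrSn_eq0 _ 1); rewrite mulr2n {1}PE exchange_big PE -big_split /=.
rewrite big1 // => i _; rewrite -big_split big1 //= => j _.
by rewrite mC eC scalerN addNr.
Qed.

End BivectorPairing.

(** * The bracket of 1-forms in terms of the Schouten bracket *)

Section KoszulBracket.
Variables (K : numFieldType) (C : comAlgType K) (A : vbundle C).
Variables (W : exteriorAlgebra A) (mu : anchored_bracket A) (sn : W -> W -> W).
Hypotheses (laP : is_lie_algebroid mu) (snP : is_schouten mu sn).
Local Notation iota := (ext_in W).
Implicit Types a b : {linear A -> C^o}.

Lemma sn_vector_wedge X Y Z :
  sn (iota X) (iota Y * iota Z)
  = iota (lbr mu X Y) * iota Z + iota Y * iota (lbr mu X Z).
Proof.
have hv Y' : mvect 1 (iota Y') := mvect_vector W Y'.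
by rewrite (sn_wedgeZ snP (hv X) (hv Y) (hv Z)) !(sn_lbr snP) scale1r.
Qed.

Lemma lbr_scale_l f X Y : lbr mu (f *: X) Y = f *: lbr mu X Y - anc mu Y f *: X.
Proof.
by rewrite (lbr_skew laP) (lbr_leibniz laP) opprD -scalerN -(lbr_skew laP).
Qed.

Lemma koszul_bracketE pi a b X : mvect 2 pi ->
  koszul_bracket mu pi a b X
  = anc mu (sharp pi a) (b X) - anc mu (sharp pi b) (a X)
    + mvpair a b (sn (iota X) pi).
Proof.
case/bivector_sum => s ->; rewrite /koszul_bracket /lieA /dA0 /dA1 !sharp_sum.
(* In each Lie derivative the [dA0] term cancels the second anchor term of [dA1]. What is left
   beside the two anchor terms of the claim is additive in the bivector, so decomposable bivectors
   suffice. *)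
suff <- : a (lbr mu (\sum_(t <- s) ((b t.1 : C) *: t.2 - (b t.2 : C) *: t.1)) X)
    - b (lbr mu (\sum_(t <- s) ((a t.1 : C) *: t.2 - (a t.2 : C) *: t.1)) X)
    - anc mu X (mvpair a b (\sum_(t <- s) iota t.1 * iota t.2))
    = mvpair a b (sn (iota X) (\sum_(t <- s) iota t.1 * iota t.2)).
  zmod.
elim: s => [|[Y Z] s IHs].
  rewrite !big_nil (sn0r snP) !mvpair0 (anc0r laP) (lbr_skew laP) (lbr0r laP).
  by rewrite oppr0 !(linear0, addr0).
rewrite !big_cons (snDr snP) !mvpairD !(lbrDl laP) !linearD /= (ancDr laP) -IHs.
suff <- : a (lbr mu ((b Y : C) *: Z - (b Z : C) *: Y) X)
    - b (lbr mu ((a Y : C) *: Z - (a Z : C) *: Y) X)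
    - anc mu X (mvpair a b (iota Y * iota Z))
    = mvpair a b (sn (iota X) (iota Y * iota Z)).
  by rewrite !(lbrDl laP) !linearD /=; zmod.
rewrite sn_vector_wedge mvpairD !mvpair_wedge !(lbrDl laP, lbrNl laP, lbr_scale_l).
rewrite (lbr_skew laP Y) (lbr_skew laP Z) !scalerN !(linearD a) !(linearD b) /=.
rewrite !(linearN a) !(linearN b) !(linearD a) !(linearD b) !(linearN a) !(linearN b).
rewrite !form_scale (ancDr laP) (ancNr laP) !(anc_der laP).
ring.
Qed.

End KoszulBracket.

Section AnchorForm.
Variables (K : numFieldType) (C : comAlgType K) (A : vbundle C).
Variables (W : exteriorAlgebra A) (mu : anchored_bracket A) (sn : W -> W -> W).
Hypotheses (laP : is_lie_algebroid mu) (snP : is_schouten mu sn).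
Local Notation iota := (ext_in W).

(** The 1-form [d^A f], bundled as a linear form so that [sharp] applies to it. *)
Definition anchor_form (f : C) (X : A) : C^o := anc mu X f.

Fact anchor_form_linear f : linear (anchor_form f).
Proof. by move=> g X Y; rewrite /anchor_form (anc_lin laP). Qed.

HB.instance Definition _ f :=
  GRing.isLinear.Build C A C^o *:%R (anchor_form f) (anchor_form_linear f).

(** Up to sign this is the Hamiltonian section of [f]. *)
Lemma sn_bivector_scalar P f : mvect 2 P ->
  sn P f%:A = - iota (sharp P (anchor_form f)).
Proof.
have hf : mvect 0 (f%:A : W) := mvect_scalar W f.
move=> hP; rewrite (sn_skewZ snP hP hf) psign_podd /= scaleN1r opprK.
have hv Y : mvect 1 (iota Y) := mvect_vector W Y.
case/bivector_sum: hP => s ->; rewrite sharp_sum linear_sum -sumrN /=.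
elim: s => [|t s IHs]; first by rewrite !big_nil (sn0r snP).
rewrite !big_cons (snDr snP) IHs; congr (_ + _).
rewrite (sn_wedgeZ snP hf (hv _) (hv _)).
rewrite !(sn_skewZ snP hf (hv _)) !psign_podd /= !scale1r scaleN1r.
rewrite !(sn_anc snP) mulNr mulrN opprK mulr_algl mulr_algr.
by rewrite (linearB iota) [iota (_ *: t.2)]linearZ [iota (_ *: t.1)]linearZ /= opprB addrC.
Qed.

End AnchorForm.

(** * Bracket identities for a Poisson-Nijenhuis pair *)

Section PoissonNijenhuisPair.
Variables (K : numFieldType) (C : comAlgType K) (A : vbundle C).
Variables (W : exteriorAlgebra A) (mu : anchored_bracket A) (sn : W -> W -> W).
Variables (pi : W) (N : {linear A -> A}) (uN : W -> W) (piN : W) (snN : W -> W -> W).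
Hypotheses (laP : is_lie_algebroid mu) (snP : is_schouten mu sn).
Hypothesis pnP : is_poisson_nijenhuis mu sn pi N.
Hypotheses (uNP : is_underline N uN) (piNP : is_piN N pi piN).
Hypothesis snNP : is_schouten (deform mu N) snN.
Local Notation iota := (ext_in W).

Let pi2 : mvect 2 pi. Proof. by case: (pn_poisson pnP). Qed.
Let piN2 : mvect 2 piN. Proof. by case: piNP. Qed.
Let nijN := pn_nijenhuis pnP.
Let laNP := deform_lie_algebroid laP nijN.

Lemma mvpair_piN a b : mvpair a b piN = mvpair a (transpose N b) pi.
Proof. by case: piNP => _ ->; rewrite -(sharpE a (transpose N b) pi2). Qed.

Lemma mvpair_transpose a b :
  mvpair (transpose N a) b pi = mvpair a (transpose N b) pi.
Proof. by rewrite -!sharpE // -(pn_sharp pnP). Qed.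

Lemma sharp_piN a : sharp piN a = N (sharp pi a).
Proof. by apply: bcoord_inj => i; rewrite sharpE // (proj2 piNP). Qed.

Lemma uN_pi : uN pi = piN *+ 2.
Proof.
have hu := uN_mvect uNP (pi2 : mvect_nat 2 pi).
apply: mvpair_inj => // [|a b]; first by apply: mvectD.
rewrite (mvpair_uN _ _ uNP pi2) mvpair_transpose mulr2n mvpairD mvpair_piN.
by [].
Qed.

Lemma uN_piN : uN piN = ext_map W N pi *+ 2.
Proof.
have hu := uN_mvect uNP (piN2 : mvect_nat 2 piN).
have hm := ext_map_mvect N (pi2 : mvect_nat 2 pi).
apply: mvpair_inj => // [|a b]; first by apply: mvectD.
rewrite (mvpair_uN _ _ uNP piN2) mulr2n mvpairD !mvpair_piN mvpair_ext_map //.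
by rewrite (mvpair_transpose a).
Qed.

Lemma uN_sn_vector_pi X :
  uN (sn (iota X) pi) = sn (iota (N X)) pi + sn (iota X) piN.
Proof.
have hv Y : mvect 1 (iota Y) := mvect_vector W Y.
have hsn Y P : mvect 2 P -> mvect 2 (sn (iota Y) P).
  exact: (sn_mvect snP (hv Y)).
apply: mvpair_inj => [||a b].
- exact/(uN_mvect uNP (n := 2%N))/hsn.
- by apply: mvectD; apply: hsn.
rewrite mvpairD (mvpair_uN _ _ uNP (hsn X pi pi2)).
have := pn_concomitant pnP a b X.
rewrite !(koszul_bracketE laP snP) // (koszul_bracketE laNP snNP) //.
rewrite -!(pn_sharp pnP) /= (sn_deform uNP snP snNP (hv X) pi2) uN_pi (uN_vector uNP).
rewrite mulr2n (snDr snP) !mvpairD mvpairN (mvpair_uN _ _ uNP (hsn X pi pi2)) => e.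
(* The anchor terms of both sides of the concomitant condition agree. Expanding the deformed bracket
   gives a second copy of each remaining term, so [e] is twice the claim. *)
apply/eqP; rewrite -subr_eq0; apply/eqP; apply: (@mulrSn_eq0 K C C^o 1).
rewrite -[RHS](subrr (0 : C)).
apply: eq_lincomb e _; zmod.
Qed.

Lemma sn_bivector_vector P X : mvect 2 P -> sn P (iota X) = - sn (iota X) P.
Proof.
by move=> hP; rewrite (sn_skewZ snP hP (mvect_vector W X : mvect 1 _)) scale1r.
Qed.

Lemma snN_pi q Q : mvect q Q -> snN pi Q = sn piN Q.
Proof.
case: q => [q|q] hQ; last by rewrite hQ (sn0r snP) (sn0r snNP).
apply/eqP; rewrite -subr_eq0; apply/eqP; move: q Q hQ.
pose D Q := snN pi Q - sn piN Q; suff: forall q Q, mvect_nat q Q -> D Q = 0 by [].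
apply: derivation_eq0 => [P Q|q X Q hQ|n g].
- by rewrite /D (snDr snP) (snDr snNP); zmod.
- have hX : mvect 1 (iota X) := mvect_vector W X.
  rewrite /D (sn_wedgeZ snNP (r := q) pi2 hX hQ) (sn_wedgeZ snP (r := q) piN2 hX hQ).
  move=> /eqP; rewrite subr_eq0 => /eqP -> /eqP; rewrite subr_eq0 => /eqP ->.
  by rewrite subrr.
case=> -[_ [x ->]]; rewrite /D.
(* On a function, [uN] of the bracket with [pi] is the bracket with [piN], by [sharp_piN]; it
   cancels one of the two copies coming from [uN pi]. *)
- rewrite (sn_deform uNP snP snNP pi2 (mvect_scalar W x : mvect 0 _)) uN_pi mulr2n (snDl snP).
  rewrite (uN_fun uNP) (sn0r snP) !(sn_bivector_scalar laP snP) //.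
  by rewrite (uNN uNP) (uN_vector uNP) sharp_piN; zmod.
rewrite (sn_deform uNP snP snNP pi2 (mvect_vector W x : mvect 1 _)) uN_pi mulr2n (snDl snP).
rewrite (uN_vector uNP) !sn_bivector_vector // (uNN uNP) uN_sn_vector_pi; zmod.
Qed.

Lemma sn_bivectorC P Q : mvect 2 P -> mvect 2 Q -> sn P Q = sn Q P.
Proof.
by move=> hP hQ; rewrite (sn_skewZ snP hP hQ) psign_podd /= scaleN1r opprK.
Qed.

Let pipi : sn pi pi = 0. Proof. by case: (pn_poisson pnP). Qed.

(** The deformed bracket of [pi] with itself is four times this bracket by [sn_deform], and equal to
    it by [snN_pi]; hence three times it is 0. *)
Lemma sn_piN_pi : sn piN pi = 0.
Proof.
apply: (@mulrSn_eq0 K C W 2); rewrite -[RHS](subrr (sn piN pi)).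
have e := sn_deform uNP snP snNP pi2 pi2.
rewrite (snN_pi pi2) uN_pi mulr2n (snDl snP) (snDr snP) pipi (uN0 uNP) in e.
rewrite (sn_bivectorC pi2 piN2) in e; rewrite mulrS mulr2n.
by apply: eq_lincomb (esym e) _; zmod.
Qed.

Lemma snN_pi_pi : snN pi pi = 0.
Proof. by rewrite (snN_pi pi2) sn_piN_pi. Qed.

Let piM := ext_map W N pi.
Let piM2 : mvect 2 piM. Proof. exact: (ext_map_mvect N (n := 2%N)). Qed.

Lemma ext_map_id_plus_pi t :
  ext_map W (id_plus N t) pi = pi + t%:A *: uN pi + t%:A *: (t%:A *: piM).
Proof.
rewrite /piM; case/bivector_sum: pi2 => s ->.
elim: s => [|[X Y] s IHs]; first by rewrite !big_nil !linear0 (uN0 uNP) !scaler0 !addr0.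
rewrite !big_cons !linearD /= IHs (uND uNP) !scalerDr.
rewrite (uN_vector_mul uNP _ (mvect_vector W _)) (uN_vector uNP) scalerDr.
rewrite !rmorphM /= !ext_map_vector /= ![iota (_ + _)]linearD /=.
rewrite [iota (_ *: N X)]linearZ [iota (_ *: N Y)]linearZ /=.
rewrite mulrDl !mulrDr -!scalerAl -!scalerAr.
zmod.
Qed.

(** Expansion of the bracket of the image of [pi] under [1 + tN] with itself; the terms of order 0
    and 1 in [t] vanish. Having [c] beside [t] lets the scalars 1, -1 and 2 be simplified in [C]. *)
Lemma sn_id_plus_pi (t : K) (c : C) : c = t%:A ->
  c *: (c *: (sn piN piN *+ 2 *+ 2 + sn pi piM *+ 2))
  + c *: (c *: (c *: (sn piN piM *+ 2 *+ 2)))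
  + c *: (c *: (c *: (c *: sn piM piM))) = 0.
Proof.
move=> ->.
have := sn_id_plus laP nijN snP snNP t (pi2 : mvect_nat 2 pi) (pi2 : mvect_nat 2 pi).
rewrite pipi snN_pi_pi scaler0 addr0 linear0 ext_map_id_plus_pi uN_pi.
rewrite !mulr2n !(snDl snP, snDr snP, snZl snP, snZr snP) !scalerDr.
rewrite (sn_bivectorC pi2 piN2) sn_piN_pi pipi (sn_bivectorC piM2 pi2).
rewrite (sn_bivectorC piM2 piN2) !scaler0 => e.
by apply: eq_lincomb e _; zmod.
Qed.

Lemma sn_piN_eq0 : sn piN piN = 0 /\ sn piN piM = 0.
Proof.
(* The coefficient of [t^2] mixes two brackets. A second relation between them comes from computing
   the deformed bracket of [pi] and [piN] both by [snN_pi] and by [sn_deform]. *)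
have e1 : sn piN piN + sn pi piM *+ 2 = 0.
  have := sn_deform uNP snP snNP pi2 piN2.
  rewrite (snN_pi piN2) uN_pi uN_piN -/piM !mulr2n (snDl snP) (snDr snP).
  rewrite (sn_bivectorC pi2 piN2) sn_piN_pi (uN0 uNP) => e.
  by apply: eq_lincomb (esym e) _; zmod.
have e2 := sn_id_plus_pi (esym (scale1r 1)).
have e3 := sn_id_plus_pi (esym (scaleN1r 1)).
have e4 := sn_id_plus_pi (esym (scaler_nat 2 (1 : C))).
rewrite !scale1r in e2; rewrite !scaleN1r in e3; rewrite !scaler_nat in e4.
have e23 : sn piN piM = 0.
  apply: (@mulrSn_eq0 K C W 7); rewrite -[RHS](subrr (0 : W)).
  (* The difference of the values at 1 and -1 is twice the cubic term, that is 8 times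
     [sn piN piM]. *)
  have e := congr2 (fun a b => a - b) e2 e3.
  apply: eq_lincomb e _; rewrite !mulrS !mulr0n; zmod.
have e5 : sn piM piM = 0.
  apply: (@mulrSn_eq0 K C W 11); rewrite -[RHS](subrr (0 : W)).
  (* Subtracting four times the value at 1 from the value at 2 removes the quadratic term and leaves
     [16 - 4 = 12] quartic ones. *)
  have e := congr2 (fun a b => a - b *+ 2 *+ 2) e4 e2.
  rewrite e23 in e; rewrite !mulrS !mulr0n; apply: eq_lincomb e _; zmod.
split=> //; apply: (@mulrSn_eq0 K C W 2); rewrite -[RHS](subrr (0 : W)).
have e := congr2 (fun a b => a - b) e2 e1.
rewrite e23 e5 in e; apply: eq_lincomb e _; rewrite !mulrS !mulr0n; zmod.
Qed.

Lemma snN_piN_piN : snN piN piN = 0.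
Proof.
have [piNN piNM] := sn_piN_eq0.
rewrite (sn_deform uNP snP snNP piN2 piN2) piNN (uN0 uNP) uN_piN -/piM.
rewrite mulr2n (snDl snP) (snDr snP) (sn_bivectorC piM2 piN2) piNM.
by rewrite !addr0 subr0.
Qed.

End PoissonNijenhuisPair.

(** * The associated L-infinity structure *)

Lemma psign_scale (K : nzRingType) (V : lmodType K) d (v : V) :
  psign K d *: v = if podd d then - v else v.
Proof. by rewrite psign_podd; case: podd; rewrite ?scaleN1r ?scale1r. Qed.

Section LowForms.
Variables (K : fieldType) (E : gradedSpace K).
Implicit Types F G : vform E.

(** Linearity in the second slot follows from the first slot by symmetry, and longer lists give
    0. *)
Lemma low_symform c F : low_form F ->
  (forall x, ghom x.1 x.2 -> ghom (x.1 + c) (F [:: x])) ->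
  (forall x y, ghom x.1 x.2 -> ghom y.1 y.2 -> ghom (x.1 + y.1 + c) (F [:: x; y])) ->
  (forall d (a : K) (x y : E), ghom d x -> ghom d y ->
    F [:: (d, a *: x + y)] = a *: F [:: (d, x)] + F [:: (d, y)]) ->
  (forall d (a : K) (x y : E) z, ghom d x -> ghom d y -> ghom z.1 z.2 ->
    F [:: (d, a *: x + y); z] = a *: F [:: (d, x); z] + F [:: (d, y); z]) ->
  (forall x y, ghom x.1 x.2 -> ghom y.1 y.2 ->
    F [:: x; y] = psign K (x.1 * y.1) *: F [:: y; x]) ->
  is_symform c F.
Proof.
move=> lF hom1F hom2F lin1F lin2F symF; split.
- case=> [|x [|y [|z xs]]]; rewrite /degsum ?big_cons ?big_nil ?addr0 /=.
  + by rewrite (low_nil lF) => _; apply: ghom0.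
  + by case=> hx _; apply: hom1F.
  + by case=> hx [hy _]; apply: hom2F.
  + by rewrite (low_big lF) // => _; apply: ghom0.
- move=> xs ys d a x y; case: xs ys => [|t [|t' xs]] [|z [|z' ys]] /=;
    try by rewrite !(low_big lF) /= ?size_cat /= ?addnS // scaler0 addr0.
  + by case=> hx _ [hy _]; apply: lin1F.
  + by case=> hx [hz _] [hy _]; apply: lin2F.
  + case=> ht [hx _] [_ [hy _]].
    rewrite symF //=; last exact: ghom_lin.
    rewrite lin2F // (symF t (d, x)) // (symF t (d, y)) //= scalerDr !scalerA.
    by rewrite [a * _]mulrC.
- case=> [|t xs] [|z ys] x y /=; last first.
  + by rewrite !(low_big lF) /= ?size_cat /= ?addnS // scaler0.
  + by rewrite !(low_big lF) /= ?size_cat /= ?addnS // scaler0.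
  + by rewrite !(low_big lF) //= scaler0.
  + by case=> hx [hy _]; apply: symF.
Qed.

Lemma eq_symform c F G : low_form F -> low_form G -> eq_vform F G ->
  is_symform c G -> is_symform c F.
Proof.
move=> lF lG FG sG; apply: low_symform => // [x hx|x y hx hy|d a x y hx hy|d a x y z hx hy hz|x y hx hy].
- by rewrite FG //; apply: hom1 sG hx.
- by rewrite FG //; apply: hom2 sG hx hy.
- rewrite !FG //=; last by split; first exact: ghom_lin.
  exact: (symform_lin sG (xs := [::]) (ys := [::])).
- rewrite !FG //=; last by split; first exact: ghom_lin.
  exact: (symform_lin sG (xs := [::]) (ys := [:: z])).
- rewrite !FG //=.
  exact: (symform_sym sG (xs := [::]) (ys := [::])).
Qed.

(** The inner values are homogeneous because [G] is a symmetric form, so agreement on homogeneous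
    arguments can be used a second time on the outer form. *)
Lemma eq_insertion11 F G : low_form F -> low_form G -> eq_vform F G ->
  is_symform 1 G -> eq_vform (insertion 1 F F) (insertion 1 G G).
Proof.
move=> lF lG FG sG [|x [|y [|z [|t xs]]]] /= hxs.
- by rewrite !insertion0.
- case: hxs => hx _; have h := hom1 sG hx.
  by rewrite !insertion1 // !FG //= !FG.
- case: hxs => hx [hy _]; have [h1 h2] := (hom1 sG hx, hom1 sG hy).
  have h3 := hom2 sG hx hy.
  by rewrite !insertion2 // !(FG [:: _]) //= ?(FG [:: x; y]) // !FG.
- case: hxs => hx [hy [hz _]]; have h1 := hom2 sG hx hy.
  have [h2 h3] := (hom2 sG hx hz, hom2 sG hy hz).
  rewrite !insertion3 // (FG [:: x; y]) // (FG [:: x; z]) // (FG [:: y; z]) //.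
  by rewrite !FG.
- by rewrite !insertion_big.
Qed.

Lemma insertion_Linfty F : low_form F -> is_symform 1 F ->
  eq_vform (insertion 1 F F) (fun=> 0) -> is_Linfty F.
Proof.
move=> lF sF FF; split=> //; first exact: low_nil.
by move=> xs hxs; rewrite RN11E FF // addr0.
Qed.

End LowForms.

(** * The associated structure is L-infinity *)

Section AssociatedStructure.
Variables (K : numFieldType) (C : comAlgType K) (A : lmodType C).
Variables (W : exteriorAlgebra A) (mu : anchored_bracket A) (sn : W -> W -> W).
Hypotheses (laP : is_lie_algebroid mu) (snP : is_schouten mu sn).
Variable pi : W.
Hypothesis piP : poisson sn pi.

Let nu : vform (mvspace W) := assoc_Linfty sn pi.
Let pi2 : mvect 2 pi. Proof. by case: piP. Qed.

Lemma jacobiator_eq0Z p q r P Q S : mvect p P -> mvect q Q -> mvect r S ->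
  jacobiator sn p q P Q S = 0.
Proof.
case: p => [p|p] hP; last first.
  by move=> _ _; rewrite hP /jacobiator !(sn0l snP) !(sn0r snP) scaler0 !subr0.
case: q => [q|q] hQ; last first.
  by move=> _; rewrite hQ /jacobiator !(sn0l snP, sn0r snP) scaler0 !subr0.
case: r => [r|r] hS; last first.
  by rewrite hS /jacobiator !(sn0r snP) scaler0 !subr0.
exact: (jacobiator_eq0 snP laP hP hQ hS).
Qed.

Lemma assoc1 d (P : W) : nu [:: (d, P)] = sn pi P.
Proof. exact: addr0. Qed.

Lemma assoc2 d e (P Q : W) :
  nu [:: (d, P); (e, Q)] = if podd d then sn P Q else - sn P Q.
Proof.
rewrite /nu /assoc_Linfty /add_vform /= add0r psign_scale poddD.
by case: podd.
Qed.

Lemma low_assoc : low_form nu.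
Proof.
split.
- exact: addr0.
- case=> [|x [|y [|z xs]]] // _; rewrite /nu /assoc_Linfty /add_vform.
  by case: x y => [? ?] [? ?]; rewrite addr0.
- by move=> d; rewrite assoc1 (sn0r snP).
- by move=> d [e P]; rewrite assoc2 (sn0l snP) oppr0; case: podd.
- by move=> d [e P]; rewrite assoc2 (sn0r snP) oppr0; case: podd.
Qed.

Lemma assoc_symform : is_symform 1 nu.
Proof.
apply: low_symform; first exact: low_assoc.
- case=> d P /= hP; rewrite assoc1 /mvhom.
  have := sn_mvect snP pi2 (hP : mvect (d + 2) P).
  by rewrite (_ : 2 + (d + 2) - 1 = d + 1 + 2); last by ring.
- case=> d P [e Q] /= hP hQ; rewrite assoc2 /mvhom.
  have := sn_mvect snP (hP : mvect (d + 2) P) (hQ : mvect (e + 2) Q).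
  rewrite (_ : d + 2 + (e + 2) - 1 = d + e + 1 + 2); last by ring.
  by case: podd => // h; rewrite -scaleN1r; apply: mvectZ.
- move=> d a P Q _ _; rewrite !assoc1; exact: sn_linr snP a P Q pi.
- move=> d a P Q [e R] _ _ _; rewrite !assoc2.
  have := sn_linl snP a P Q R => e1.
  case: podd; first exact: e1.
  have := congr1 -%R e1; rewrite opprD -scalerN; exact.
- case=> d P [e Q] /= hP hQ; rewrite !assoc2 psign_scale.
  have := sn_skewZ snP (hP : mvect (d + 2) P) (hQ : mvect (e + 2) Q).
  rewrite psign_podd !(poddD, poddM) => ->.
  by case: (podd d) (podd e) => [] [] /=; rewrite ?scaleN1r ?scale1r ?opprK.
Qed.

(** Arities 1, 2 and 3 are the graded Jacobi identity with two, one and no arguments equal to [pi];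
    in arity 1 it yields twice the square of the bracket with [pi]. *)
Lemma assoc_is_Linfty : is_Linfty nu.
Proof.
have lnu := low_assoc.
apply: insertion_Linfty; [exact: low_assoc|exact: assoc_symform|].
move=> [|[d P] [|[e Q] [|[f R] [|t xs]]]] /=.
- by rewrite insertion0.
- case=> hP _; rewrite insertion1 // !assoc1.
  have := jacobiator_eq0Z pi2 pi2 (hP : mvect (d + 2) P).
  rewrite /jacobiator (proj2 piP) (sn0l snP) psign_podd /= scaleN1r opprK subr0.
  by rewrite -mulr2n; apply: mulrSn_eq0.
- case=> hP [hQ _]; rewrite insertion2 // !assoc1 !assoc2 /=.
  have hP2 : mvect (d + 2) P := hP; have hQ2 : mvect (e + 2) Q := hQ.
  have := jacobiator_eq0Z pi2 hP2 hQ2.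
  rewrite /jacobiator.
  have := sn_skewZ snP (sn_mvect snP pi2 hQ2) hP2 => ->.
  rewrite psign_scale !psign_podd !(poddD, poddM, poddN) /=.
  case: (podd d) (podd e) => [] [] /=; rewrite ?(scaleN1r, scale1r, snNr snP, opprK) => h;
  first [apply: eq_lincomb h _; zmod | apply: eq_lincomb (congr1 -%R h) _; zmod].
- case=> hP [hQ [hR _]]; rewrite insertion3 // !assoc2 /=.
  have hP2 : mvect (d + 2) P := hP; have hQ2 : mvect (e + 2) Q := hQ.
  have hR2 : mvect (f + 2) R := hR.
  have := jacobiator_eq0Z hP2 hQ2 hR2.
  rewrite /jacobiator.
  have e1 := sn_skewZ snP (sn_mvect snP hP2 hR2) hQ2.
  have e2 := sn_skewZ snP (sn_mvect snP hQ2 hR2) hP2.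
  move: e1 e2; rewrite !psign_scale !(poddD, poddM, poddN) /=.
  case: (podd d) (podd e) (podd f) => [] [] [] /=;
    rewrite ?(scaleN1r, scale1r, snNl snP, opprK) => -> ->; move=> h;
  first [apply: eq_lincomb h _; zmod | apply: eq_lincomb (congr1 -%R h) _; zmod].
- by move=> _; rewrite insertion_big.
Qed.

End AssociatedStructure.

Section UnderlineForm.
Variables (K : numFieldType) (C : comAlgType K) (A : lmodType C).
Variables (W : exteriorAlgebra A) (N : {linear A -> A}) (uN : W -> W).
Hypothesis uNP : is_underline N uN.
Let U : vform (mvspace W) := underline_form uN.

Lemma low_underline : low_form U.
Proof.
split=> //=; first by case=> [|[? ?] [|? ?]].
- by move=> d; apply: uN0 uNP.
- by move=> _ [].
Qed.

Lemma underline_symform : is_symform 0 U.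
Proof.
apply: low_symform; first exact: low_underline.
- by case=> d P; rewrite addr0; apply: (uN_mvectZ uNP (p := d + 2)).
- by case=> d P [e Q] /= _ _; apply: mvect0.
- by move=> d a P Q _ _; apply: (uN_lin uNP a P Q).
- by move=> d a P Q [e R] _ _ _; rewrite /= scaler0 addr0.
- by case=> d P [e Q] _ _; rewrite /= scaler0.
Qed.

End UnderlineForm.

Theorem proposition7p8 (K : numFieldType) (C : comAlgType K) (A : vbundle C)
  (W : exteriorAlgebra A)
  (mu : anchored_bracket A) (sn : W -> W -> W)
  (pi : W) (N : {linear A -> A})
  (uN : W -> W) (piN : W) (snN : W -> W -> W) :
  is_lie_algebroid mu ->
  is_schouten mu sn ->
  is_poisson_nijenhuis mu sn pi N ->
  is_underline N uN ->
  is_piN N pi piN ->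
  is_schouten (deform mu N) snN ->
  let nu := assoc_Linfty sn pi in
  let nuN := RN 0 1 (underline_form uN) nu in
  [/\ is_Linfty nu,
      weak_nijenhuis (underline_form uN) nu
    & [/\ is_lie_algebroid (deform mu N),
          poisson sn (- piN) /\ poisson snN (- piN),
          is_Linfty nuN,
          eq_vform nuN (add_vform (l1 sn (- piN)) (l2 snN))
        & eq_vform nuN (assoc_Linfty snN (- pi))]].
Proof.
move=> laP snP pnP uNP piNP snNP nu nuN.
have piP := pn_poisson pnP; have [pi2 _] := piP; have [piN2 _] := piNP.
have laNP := deform_lie_algebroid laP (pn_nijenhuis pnP).
have oppr2 (P : W) : mvect 2 P -> mvect 2 (- P).
  by rewrite -scaleN1r; apply: mvectZ.
have piNP' : poisson snN (- pi).
  split; first exact: oppr2.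
  rewrite (snNl snNP) (snNr snNP) (snN_pi_pi laP snP pnP uNP piNP snNP).
  by rewrite !oppr0.
have snNpi := snN_pi laP snP pnP uNP piNP snNP.
have [lU sU] := (low_underline uNP, underline_symform uNP).
have uU x y : underline_form uN [:: x; y] = 0 by case: x.
have [lnu snu] := (low_assoc snP pi, assoc_symform snP piP).
have [lnu' snu'] := (low_assoc snNP (- pi), assoc_symform snNP piNP').
have lnuN : low_form nuN := low_der lU uU lnu.
have nuNE : eq_vform nuN (assoc_Linfty snN (- pi)).
  move=> [|[d P] [|[e Q] [|z xs]]]; last by rewrite (low_big lnuN) // (low_big lnu').
  - by rewrite (low_nil lnuN) (low_nil lnu').
  - case=> hP _; rewrite /nuN der1 // /nu !assoc1 /= (snNl snNP).
    have := sn_deform uNP snP snNP pi2 (hP : mvect (d + 2) P).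
    rewrite (snNpi _ _ (hP : mvect (d + 2) P)) (uN_pi pnP uNP piNP) mulr2n.
    (* Here [sn pi (uN P) - uN (sn pi P)] is the deformed bracket of [pi] and [P] minus that of
       [uN pi] and [P], that is one minus two copies of [sn piN P]. *)
    rewrite (snDl snP) => e; apply: eq_lincomb (congr1 -%R e) _; zmod.
  - case=> hP [hQ _]; rewrite /nuN der2 // /nu !assoc2 /=.
    rewrite (sn_deform uNP snP snNP (hP : mvect (d + 2) P) (hQ : mvect (e + 2) Q)).
    by case: podd; rewrite ?(uNN uNP); zmod.
have snuN : is_symform 1 nuN := eq_symform lnuN lnu' nuNE snu'.
have nuL : is_Linfty nu := assoc_is_Linfty laP snP piP.
have nuNL : is_Linfty nuN.
  have [_ _ nuN'0] := assoc_is_Linfty laNP snNP piNP'.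
  split=> //; first exact: low_nil.
  move=> xs hxs; rewrite -(nuN'0 xs hxs) !RN11E.
  by rewrite (eq_insertion11 lnuN lnu' nuNE snu').
have nunuN : eq_vform (RN 1 1 nu nuN) (fun=> 0).
  move=> xs hxs; have [_ _ nu0] := nuL.
  (* Differentiating [[nu, nu] = 0] gives [[nuN, nu] + [nu, nuN] = 0]. The two summands are equal in
     degree 1, and 2 is cancelled. *)
  have := RN_der lU sU uU lnu lnu snu snu nu0 hxs.
  rewrite !RN11E -/nuN [insertion 1 nuN nu xs + _]addrC -mulr2n.
  exact: (@mulrSn_eq0 K C W 1).
split=> //.
  split=> // xs hxs; have [_ _ nuN0] := nuNL.
  (* Differentiating [[nu, nuN] = 0] gives the sum of [[nuN, nuN]], already known to vanish, and the
     weak Nijenhuis expression. *)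
  have := RN_der lU sU uU lnu lnuN snu snuN nunuN hxs.
  by rewrite nuN0 // add0r.
split=> //.
  have [piNN _] := sn_piN_eq0 laP snP pnP uNP piNP snNP.
  have piNN' := snN_piN_piN laP snP pnP uNP piNP snNP.
  split; split; rewrite ?(snNl snP) ?(snNr snP) ?(snNl snNP) ?(snNr snNP);
    by rewrite ?piNN ?piNN' ?oppr0; do ?exact: oppr2.
(* The two descriptions differ only in their unary parts, the bracket with [- pi] for [snN] and with
   [- piN] for [sn], which [snN_pi] identifies. *)
move=> xs hxs; rewrite nuNE //; case: xs hxs => [|[d P] [|[e Q] xs]] //= [hP _].
rewrite /assoc_Linfty /add_vform /= (snNl snNP) (snNl snP).
by rewrite (snNpi _ _ (hP : mvect (d + 2) P)).
Qed.
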